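(* $$\sum_{m\ge0}\ \sum_{\lambda\vdash m}\ \sum_{\vec m,\vec p}S_\lambda^{\vec m}(\mathbf x^{(1)},\dots,\mathbf x^{(n)})\,S_\lambda^{\vec p}(\mathbf y^{(1)},\dots,\mathbf y^{(n)})=\prod_{i,j\ge1}\frac{1}{1-\sum_{k,l=1}^n x_i^{(k)}y_j^{(l)}},$$ where $\vec m,\vec p$ range over vectors of $n$ nonnegative integers whose entries sum to $m$.
   Context: Take commuting variables $x^{(k)}_i$ and $y^{(k)}_i$ ($i\ge1$, $1\le k\le n$). Let $A=\{i^{(k)}:i\ge1,1\le k\le n\}$ be partially ordered by $i^{(k)}<j^{(l)}$ iff $i<j$. A dotted Young tableau of shape $\lambda$ and multidegree $\vec m=[m_1,\dots,m_n]$ is a filling of the Young diagram of $\lambda$ with elements of $A$, rows weakly increasing and columns strictly increasing in this order, with exactly $m_k$ entries of the form $i^{(k)}$ for each $k$. $S_\lambda^{\vec m}(\mathbf x^{(1)},\dots,\mathbf x^{(n)})=\sum_T\prod_{i^{(j)}\in T}x_i^{(j)}$ over all such tableaux $T$ (product over entries with multiplicity), and $S_\lambda^{\vec p}(\mathbf y^{(1)},\dots,\mathbf y^{(n)})$ is defined in the same way with $y$ in place of $x$. *)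

(* Defs.v *)
From HB Require Import structures.
From mathcomp Require Import all_boot all_algebra.
From mathcomp Require Import finmap multiset all_classical.

Set Implicit Arguments.
Unset Strict Implicit.
Unset Printing Implicit Defensive.

Import GRing.Theory.

Local Open Scope mset_scope.
Local Open Scope classical_set_scope.
Local Open Scope ring_scope.

(* Formal power series with coefficients in R in the commuting variables
   indexed by V, of which there may be infinitely many. A monomial is a finite
   multiset of variables, and a series is the function mapping each monomial to
   its coefficient. This is a definition rather than a notation so that
   multiplication is the Cauchy product and not the pointwise product of
   functions. *)
Definition fps (V : choiceType) (R : Type) : Type := {mset V} -> R.

HB.instance Definition _ (V : choiceType) (R : zmodType) :=
  GRing.Zmodule.copy (fps V R) ({mset V} -> R).

Section FormalPowerSeriesRing.
Variables (V : choiceType) (R : comNzRingType).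
Implicit Types (f g h : fps V R) (M N : {mset V}).

Definition fps_mono M : fps V R := fun N => (N == M)%:R.

Definition fps_one : fps V R := fps_mono mset0.

(* The set of factorisations of M is finite, by finite_factorisations. *)
Definition fps_mul f g : fps V R := fun M =>
  \sum_(p \in [set p : {mset V} * {mset V} | (p.1 `+` p.2)%mset = M]) f p.1 * g p.2.

Lemma finite_divisors M : finite_set [set N | msubset N M].
Proof.
pose d := (\sum_(x <- finsupp M) M x)%N.
pose T := {ffun finsupp M -> 'I_d.+1}.
pose F (t : T) : {mset V} :=
  [fsfun[tt] x in finsupp M => oapp (fun y => t y : nat) 0%N (insub x)].
apply: (@sub_finite_set _ _ (F @` [set: T])); last first.
  by apply: finite_image; exact: finite_finset.
move=> N /= /msubsetP NM.
exists [ffun x : finsupp M => inord (N (val x))] => //.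
apply/fsfunP => x; rewrite fsfunE.
case: ifPn => [xM|xM].
  rewrite insubT /= ffunE /= inordK // ltnS (leq_trans (NM x)) //.
  by rewrite /d (big_fsetD1 x) //= leq_addr.
by have := NM x; rewrite (fsfun_dflt xM) leqn0 => /eqP ->.
Qed.

Lemma finite_factorisations M :
  finite_set [set p : {mset V} * {mset V} | (p.1 `+` p.2)%mset = M].
Proof.
apply: (@sub_finite_set _ _
  ([set N | msubset N M] `*` [set N | msubset N M])); last first.
  by apply: finite_setX; exact: finite_divisors.
move=> [A B] /= <-; split => /=; apply/msubsetP => x; rewrite msetE2.
- exact: leq_addr.
- exact: leq_addl.
Qed.

(* The Cauchy product as a finite double sum over any finite set of monomials
   that contains all the divisors of M. *)
Lemma fps_mulE (D : {fset {mset V}}) f g M :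
  (forall N, msubset N M -> N \in D) ->
  fps_mul f g M =
  \sum_(A <- D) \sum_(B <- D) if (A `+` B)%mset == M then f A * g B else 0.
Proof.
move=> DM;
rewrite /fps_mul.
pose s := [seq p <- [seq (A, B) | A <- D, B <- D] | (p.1 `+` p.2)%mset == M].
have us : uniq s.
  by rewrite filter_uniq// allpairs_uniq// => -[? ?] [? ?] _ _ [-> ->].
rewrite (_ : [set p | _] = [set` s]); last first.
  apply/seteqP; split => [[A B] /= ABM|[A B]]; rewrite /= mem_filter /=.
    rewrite ABM eqxx /=; apply/allpairsP; exists (A, B) => /=; split=> //.
      by apply: DM; rewrite -ABM; apply/msubsetP => x; rewrite msetE2 leq_addr.
    by apply: DM; rewrite -ABM; apply/msubsetP => x; rewrite msetE2 leq_addl.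
  by case/andP => /eqP.
by rewrite -fsbig_seq//= big_filter big_mkcond big_allpairs.
Qed.

Definition mdivisors M : {fset {mset V}} := fset_set [set N | msubset N M].

Lemma in_mdivisors M N : (N \in mdivisors M) = msubset N M.
Proof.
rewrite in_fset_set; last exact: finite_divisors.
by apply/idP/idP; rewrite inE.
Qed.

Lemma fps_mulC : commutative fps_mul.
Proof.
move=> f g; apply/funext => M.
have H N : msubset N M -> N \in mdivisors M by rewrite in_mdivisors.
rewrite !(fps_mulE _ _ H) exchange_big /=.
by do 2!apply: eq_bigr => ? _; rewrite msetDC mulrC.
Qed.

Lemma fps_mul1 : left_id fps_one fps_mul.
Proof.
move=> f; apply/funext => M.
have H N : msubset N M -> N \in mdivisors M by rewrite in_mdivisors.
have M0 : mset0 \in mdivisors M.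
  by apply: H; apply/msubsetP => x; rewrite mset0E.
have MM : M \in mdivisors M by apply: H; exact: msubset_refl.
rewrite (fps_mulE _ _ H) (big_fsetD1 mset0)//= [X in _ + X]big1_seq ?addr0.
  rewrite (big_fsetD1 M)//= mset0D eqxx /fps_one/fps_mono eqxx mul1r.
  rewrite big1_seq ?addr0// => N /=; rewrite !inE mset0D.
  by case/andP => /negPf ->.
move=> N /=; rewrite !inE => /andP[/negPf N0 _].
by apply: big1 => B _; rewrite /fps_one/fps_mono N0 mul0r if_same.
Qed.

Lemma fps_mulDl : left_distributive fps_mul +%R.
Proof.
move=> f g h; apply/funext => M.
have H N : msubset N M -> N \in mdivisors M by rewrite in_mdivisors.
rewrite [RHS](_ : _ = fps_mul f h M + fps_mul g h M)// !(fps_mulE _ _ H).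
rewrite -big_split; apply: eq_bigr => A _.
rewrite -big_split; apply: eq_bigr => B _ /=.
by case: ifP => _; rewrite ?addr0// mulrDl.
Qed.

Lemma fps_mul3E f g h M : let D := mdivisors M in
  fps_mul (fps_mul f g) h M =
  \sum_(A <- D) \sum_(B <- D) \sum_(C <- D)
    if (A `+` B `+` C)%mset == M then f A * g B * h C else 0.
Proof.
move=> D.
have H N : msubset N M -> N \in D by rewrite in_mdivisors.
rewrite (fps_mulE _ _ H) exchange_big /=.
transitivity (\sum_(C <- D) \sum_(A <- D) \sum_(B <- D)
    if (A `+` B `+` C)%mset == M then f A * g B * h C else 0); last first.
  by rewrite exchange_big; apply: eq_bigr => A _; rewrite exchange_big.
apply: eq_bigr => C _.
transitivity (\sum_(N <- D) \sum_(A <- D) \sum_(B <- D)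
    if ((N `+` C)%mset == M) && ((A `+` B)%mset == N)
    then f A * g B * h C else 0).
  apply: eq_big_seq => N; rewrite in_mdivisors => NM.
  have HN N' : msubset N' N -> N' \in D.
    by move=> N'N; apply: H; exact: msubset_trans NM.
  rewrite (fps_mulE _ _ HN); case: eqP => _ /=; last first.
    by rewrite big1// => A _; rewrite big1.
  rewrite mulr_suml; apply: eq_bigr => A _.
  by rewrite mulr_suml; apply: eq_bigr => B _; case: ifP; rewrite ?mul0r.
rewrite exchange_big; apply: eq_bigr => A _.
rewrite exchange_big; apply: eq_bigr => B _ /=.
case: eqP => [ABC|ABC].
  have ABD : (A `+` B)%mset \in D.
    apply: H; rewrite -ABC; apply/msubsetP => x.
    by rewrite [(A `+` B `+` C)%mset x]msetE2 leq_addr.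
  rewrite (big_fsetD1 (A `+` B)%mset)//= ABC !eqxx /= big1_seq ?addr0//.
  by move=> N /=; rewrite !inE eq_sym => /andP[/negPf -> _]; rewrite andbF.
by apply: big1 => N _; case: eqP => //= NC; case: eqP => // AB; case: ABC; rewrite AB.
Qed.

Lemma fps_mulA : associative fps_mul.
Proof.
move=> f g h; rewrite [LHS]fps_mulC; apply/funext => M.
rewrite !fps_mul3E [RHS]exchange_big /=.
rewrite [LHS](_ : _ = \sum_(B <- mdivisors M) \sum_(C <- mdivisors M)
  \sum_(A <- mdivisors M)
    if (B `+` C `+` A)%mset == M then g B * h C * f A else 0)//.
apply: eq_bigr => B _; rewrite [LHS]exchange_big /=.
apply: eq_bigr => A _; apply: eq_bigr => C _.
rewrite msetDC msetDA.
by case: ifP => // _; rewrite mulrC mulrA.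
Qed.

Lemma fps_one_neq0 : fps_one != 0 :> fps V R.
Proof.
apply/eqP => /(congr1 (fun f : fps V R => f mset0)).
by rewrite /fps_one/fps_mono eqxx; apply/eqP; exact: oner_neq0.
Qed.

HB.instance Definition _ := GRing.Zmodule_isComNzRing.Build (fps V R)
  fps_mulA fps_mulC fps_mul1 fps_mulDl fps_one_neq0.

Definition fps_unit : {pred fps V R} := fun f => `[< exists g, g * f = 1 >].

(* The multiplicative inverse of f when there is one, and f otherwise; there is
   one when f has constant coefficient 1, by fps_unit_subr1. *)
Definition fps_inv f : fps V R := xget f [set g | g * f = 1].

Lemma fps_mulVf : {in fps_unit, left_inverse 1 fps_inv *%R}.
Proof.
by move=> f /asboolP [g gf]; rewrite /fps_inv; case: xgetP => [? -> //|/(_ g)].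
Qed.

Lemma fps_unitPl f g : g * f = 1 -> fps_unit f.
Proof. by move=> gf; apply/asboolP; exists g. Qed.

Lemma fps_inv_out : {in [predC fps_unit], fps_inv =1 id}.
Proof.
move=> f /asboolPn nf; rewrite /fps_inv; case: xgetP => // g _ gf.
by case: nf; exists g.
Qed.

HB.instance Definition _ := GRing.ComNzRing_hasMulInverse.Build (fps V R)
  fps_mulVf fps_unitPl fps_inv_out.

Lemma eq_fps_mul f f' g g' M :
  (forall N, msubset N M -> f N = f' N) ->
  (forall N, msubset N M -> g N = g' N) -> (f * g) M = (f' * g') M.
Proof.
move=> ff' gg'; have H N : msubset N M -> N \in mdivisors M.
  by rewrite in_mdivisors.
rewrite -[LHS]/(fps_mul f g M) -[RHS]/(fps_mul f' g' M) !(fps_mulE _ _ H).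
apply: eq_big_seq => A; rewrite in_mdivisors => AM.
apply: eq_big_seq => B; rewrite in_mdivisors => BM.
by rewrite ff'// gg'.
Qed.

Lemma size_msetD (A B : {mset V}) :
  size (A `+` B)%mset = (size A + size B)%N.
Proof.
rewrite -size_cat; apply/perm_size/allP => x _ /=.
by rewrite count_cat !count_mem_mset msetE2.
Qed.

Lemma fps_exp_eq0 f (k : nat) M :
  f mset0 = 0 -> (size M < k)%N -> (f ^+ k) M = 0.
Proof.
move=> f0; elim: k M => // k IHk M Mk.
have H N : msubset N M -> N \in mdivisors M by rewrite in_mdivisors.
rewrite exprS -[LHS]/(fps_mul f (f ^+ k) M) (fps_mulE _ _ H).
rewrite big1// => A _; rewrite big1// => B _; case: eqP => // ABM.
have [->|A0] := eqVneq A mset0; first by rewrite f0 mul0r.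
rewrite [X in _ * X]IHk ?mulr0//.
move: Mk; rewrite -ABM size_msetD ltnS; apply: leq_trans.
rewrite -[X in (X < _)%N]add0n ltn_add2r lt0n size_eq0.
apply: contra A0 => /eqP A0; apply/eqP/msetP => x.
by rewrite mset0E -count_mem_mset A0.
Qed.

Lemma fps_unit_subr1 f : f mset0 = 0 -> (1 - f) \is a GRing.unit.
Proof.
move=> f0; apply/asboolP.
pose G (N : nat) : fps V R := \sum_(k < N) f ^+ k.
have GE k M : (size M < k)%N -> G k M = G (size M).+1 M.
  elim: k => // k IHk; rewrite ltnS leq_eqVlt => /predU1P[->//|Mk].
  rewrite -IHk// /G big_ord_recr /= -[LHS]/(_ M + _ M).
  by rewrite (fps_exp_eq0 f0 Mk) addr0.
exists (fun M => G (size M).+1 M); apply/funext => M.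
transitivity ((G (size M).+1 * (1 - f)) M).
  apply: eq_fps_mul => // A AM; rewrite -(GE (size M).+1)// ltnS.
  by have := size_msetD (M `\` A)%mset A; rewrite msetBDK// => ->; exact: leq_addl.
rewrite (_ : _ * _ = 1 - f ^+ (size M).+1).
  by rewrite -[LHS]/(_ M - _ M) fps_exp_eq0// subr0.
by rewrite -(opprB (f ^+ _)) subrX1 -mulNr opprB mulrC.
Qed.

Lemma fps_monoM (A B : {mset V}) :
  fps_mono A * fps_mono B = fps_mono (A `+` B)%mset.
Proof.
apply/funext => M; have H N : msubset N M -> N \in mdivisors M.
  by rewrite in_mdivisors.
rewrite -[LHS]/(fps_mul _ _ M) (fps_mulE _ _ H).
transitivity (\sum_(A' <- mdivisors M) \sum_(B' <- mdivisors M)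
    ((A' == A) && (B' == B) && ((A `+` B)%mset == M))%:R : R).
  apply: eq_bigr => A' _; apply: eq_bigr => B' _.
  rewrite /fps_mono; case: (eqVneq A' A) => [->|_]; last by rewrite mul0r if_same.
  by case: (eqVneq B' B) => [->|_]; rewrite ?mulr0 ?mulr1 /= ?if_same//; case: ifP.
rewrite /fps_mono [in RHS]eq_sym; case: (eqVneq (A `+` B)%mset M) => ABM; last first.
  by rewrite big1// => ? _; rewrite big1// => ? _; rewrite andbF.
have AD : A \in mdivisors M.
  by apply: H; rewrite -ABM; apply/msubsetP => x; rewrite msetE2 leq_addr.
have BD : B \in mdivisors M.
  by apply: H; rewrite -ABM; apply/msubsetP => x; rewrite msetE2 leq_addl.
rewrite (big_fsetD1 A AD) /= [X in _ + X]big1_seq; last first.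
  move=> A' /=; rewrite !inE => /andP[/negPf -> _].
  by rewrite big1.
rewrite addr0 (big_fsetD1 B BD) /= [X in _ + X]big1_seq; last first.
  by move=> B' /=; rewrite !inE => /andP[/negPf -> _]; rewrite andbF.
by rewrite addr0 (eqxx A) (eqxx B).
Qed.

Definition fps_var (v : V) : fps V R := fps_mono [mset v].

Lemma fps_prod_var (s : seq V) :
  \prod_(v <- s) fps_var v = fps_mono (seq_mset s).
Proof.
elim: s => [|v s IHs].
  rewrite big_nil; congr fps_mono.
  by apply/msetP => x; rewrite mset_seqE mset0E.
rewrite big_cons IHs fps_monoM; congr fps_mono.
by apply/msetP => x; rewrite msetE2 !mset_seqE msetnE /= eq_sym; case: eqP.
Qed.

End FormalPowerSeriesRing.

(* Infinite sums and products of power series are limits over the finite sets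
   of indices, ordered by inclusion, for coefficientwise convergence: every
   coefficient is eventually constant. *)
Definition fps_has_sum (V I : choiceType) (R : comNzRingType)
    (F : I -> fps V R) (s : fps V R) : Prop :=
  forall M, exists J0 : {fset I}, forall J : {fset I},
    (J0 `<=` J)%fset -> (\sum_(i <- J) F i) M = s M.

Definition fps_has_prod (V I : choiceType) (R : comNzRingType)
    (F : I -> fps V R) (s : fps V R) : Prop :=
  forall M, exists J0 : {fset I}, forall J : {fset I},
    (J0 `<=` J)%fset -> (\prod_(i <- J) F i) M = s M.

(* The letter i^(k) is the pair of i : nat and k : 'I_n, both counted from 0. *)
Definition letter (n : nat) : Type := nat * 'I_n.
HB.instance Definition _ n := Choice.on (letter n).

Definition letter_lt n (a b : letter n) : bool := (a.1 < b.1)%N.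

(* A row is weakly increasing if it never goes down: letters with the same i
   may follow each other in any order, although letter_lt does not compare
   them, so that 1^(2) 1^(1) and 1^(1) 1^(2) are both weakly increasing. *)
Definition letter_le n (a b : letter n) : bool := ~~ letter_lt b a.

Definition is_partition (m : nat) (la : seq nat) : Prop :=
  [/\ sorted geq la, 0%N \notin la & sumn la = m].

(* A filling of a Young diagram is the sequence of its rows, from the top. *)
Definition column n (T : seq (seq (letter n))) (c : nat) : seq (letter n) :=
  pmap (fun row => onth row c) T.

Definition dotted_tableau n (la : seq nat) (mu : {ffun 'I_n -> nat})
    (T : seq (seq (letter n))) : Prop :=
  [/\ shape T = la,
      forall row, row \in T -> sorted (@letter_le n) row,
      forall c, sorted (@letter_lt n) (column T c)
    & forall k, count (fun a : letter n => a.2 == k) (flatten T) = mu k].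

(* The sum over the dotted tableaux T of the product of the z a, for a ranging
   over the entries of T. It is taken coefficient by coefficient: infinitely many
   tableaux occur, but when the z a are distinct variables only finitely many
   contribute to a given monomial, by dotted_schur_finite_support. *)
Definition dotted_schur (V : choiceType) (R : comNzRingType) n
    (la : seq nat) (mu : {ffun 'I_n -> nat}) (z : letter n -> fps V R) :
    fps V R := fun M =>
  \sum_(T \in dotted_tableau la mu) (\prod_(a <- flatten T) z a) M.

Definition xvar (R : comNzRingType) n (a : letter n) :
  fps (letter n + letter n)%type R := fps_var R (inl a).

Definition yvar (R : comNzRingType) n (a : letter n) :
  fps (letter n + letter n)%type R := fps_var R (inr a).

Lemma dotted_schur_finite_support (V : choiceType) (R : comNzRingType) n
    (la : seq nat) (mu : {ffun 'I_n -> nat}) (h : letter n -> V)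
    (M : {mset V}) : injective h ->
  finite_set (dotted_tableau la mu `&`
    [set T | (\prod_(a <- flatten T) fps_var R (h a)) M != 0]).
Proof.
move=> h_inj; pose F (T : seq (seq (letter n))) := map h (flatten T).
set D := (X in finite_set X).
have F_inj : {in D &, injective F}.
  move=> T U; rewrite !inE => -[[Tla _ _ _] _] [[Ula _ _ _] _].
  by move=> /(inj_map h_inj) TU; rewrite -(flattenK T) -(flattenK U) TU Tla Ula.
rewrite -(eq_finite_set (inj_card_eq F_inj)).
apply: (@sub_finite_set _ _ [set` permutations (enum_mset M)]).
  move=> _ /= [T [_ /=] + <-].
  rewrite -(big_map h xpredT (fun v => fps_var R v)) fps_prod_var.
  rewrite /fps_mono; case: (M =P _) => [ME _|_]; last by rewrite eqxx.
  by rewrite mem_permutations ME perm_sym; exact: perm_eq_seq_mset.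
exact: finite_seq.
Qed.

Definition multidegrees n (m : nat) : set {ffun 'I_n -> nat} :=
  [set mu | (\sum_(k < n) mu k)%N = m].

Lemma finite_multidegrees n m : finite_set (@multidegrees n m).
Proof.
pose F (t : {ffun 'I_n -> 'I_m.+1}) : {ffun 'I_n -> nat} :=
  [ffun k => t k : nat].
apply: (@sub_finite_set _ _ (F @` [set: _])); last first.
  by apply: finite_image; exact: finite_finset.
move=> mu /= mum; exists [ffun k => inord (mu k)] => //.
apply/ffunP => k; rewrite !ffunE inordK// ltnS -mum.
by rewrite (bigD1 k)//= leq_addr.
Qed.

Lemma finite_partitions m : finite_set (is_partition m).
Proof.
pose F (t : {k : 'I_m.+1 & k.-tuple 'I_m.+1}) : seq nat :=
  [seq val i | i <- tagged t].
apply: (@sub_finite_set _ _ (F @` [set: _])); last first.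
  by apply: finite_image; exact: finite_finset.
move=> la [_ la0 lam].
have le_size : (size la < m.+1)%N.
  rewrite ltnS -lam {lam}; elim: la la0 => //= a la IHla.
  rewrite inE eq_sym negb_or -lt0n => /andP[a0 /IHla].
  by move=> /(leq_add a0).
have le_part : all (fun i => i < m.+1)%N la.
  rewrite -lam {lam la0 le_size}; elim: la => //= a la IHla.
  rewrite ltnS leq_addr; apply: sub_all IHla => i /leq_trans; apply.
  by rewrite ltnS leq_addl.
have szP : size [seq inord i : 'I_m.+1 | i <- la] == Ordinal le_size.
  by rewrite size_map.
exists (Tagged (fun k : 'I_m.+1 => k.-tuple 'I_m.+1) (Tuple szP)) => //.
rewrite /F /= -map_comp map_id_in// => i /(allP le_part) im.
by rewrite /= inordK.
Qed.

(* Main.v *)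
Require Import Defs.
From mathcomp Require Import all_boot all_algebra.
From mathcomp Require Import finmap multiset all_classical.
From mathcomp Require Import zify.

(* Giving each entry of a semistandard tableau an arbitrary dot k shows that the
   sum over the multidegrees of the S_lambda is the Schur function s_lambda in
   the variables X_i = sum_k x_i^(k), so the theorem is the Cauchy identity in
   X_i and Y_j = sum_l y_j^(l).

   Reading a tableau as a chain of partitions that grow by horizontal strips
   gives s_lambda(X_0, ..., X_(N-1)) as the coefficient of lambda in
   U(X_(N-1)) ... U(X_0) applied to the empty partition, where U(x) adds a
   horizontal strip, counted by x to its size. If D(y) is the adjoint operator,
   which removes a strip, then (1 - xy) D(y) U(x) = U(x) D(y): the partitions nu
   above la and mu with a given first row are matched with the partitions ka
   below la and mu by reflecting each row in the interval in which it is free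
   to move. Commuting all the D(Y_j) past all the U(X_i) produces the product.

   The coefficients of degree at most m only involve partitions of at most m,
   and only the variables dividing the monomial, so all this is done with finite
   sums, up to a congruence of power series. *)

Set Implicit Arguments.
Unset Strict Implicit.
Unset Printing Implicit Defensive.

Import GRing.Theory.

(** * Padded partitions and horizontal strips *)

Lemma geq_trans : transitive geq.
Proof. by move=> x y z /= yx zx; exact: leq_trans yx. Qed.

(* Contains the partitions of at most m, padded with zeros to m + 1 rows, so that
   their last row is empty; the other members interlace with nothing. *)
Definition box (m : nat) : seq (seq nat) :=
  [seq s <- [seq [seq val i | i <- tval t] | t : m.+1.-tuple 'I_m.+1]
  | (sumn s <= m)].

Lemma leq_nth_sumn (s : seq nat) i : (nth 0 s i <= sumn s).
Proof.
elim: s i => [|a s IHs] [|i] //=; first exact: leq_addr.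
by rewrite (leq_trans (IHs i))// leq_addl.
Qed.

Lemma mem_box m s : (s \in box m) = (size s == m.+1) && (sumn s <= m).
Proof.
rewrite mem_filter andbC; apply/andP/andP => -[+ sm].
  by case/mapP => t _ sE; split=> //; rewrite sE size_map size_tuple.
move=> szs; split=> //.
have szP : size [seq inord i : 'I_m.+1 | i <- s] == m.+1 by rewrite size_map.
apply/mapP; exists (Tuple szP); first by rewrite mem_enum.
rewrite /= -map_comp map_id_in// => i /(nthP 0) [k _ <-] /=.
by rewrite inordK// ltnS (leq_trans (leq_nth_sumn _ _)).
Qed.

Lemma box_uniq m : uniq (box m).
Proof.
rewrite filter_uniq// map_inj_uniq ?enum_uniq//.
by move=> s t /inj_map st; apply/val_inj/st/val_inj.
Qed.

(** For sequences of the same length this says that la/mu is a horizontal strip; it forces both of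
    them to be weakly decreasing. *)
Definition interlace (mu la : seq nat) : bool :=
  all (fun i => (nth 0 mu i <= nth 0 la i) && (nth 0 la i.+1 <= nth 0 mu i))
    (iota 0 (size la)).

Lemma interlaceP mu la : size mu = size la ->
  reflect (forall i, nth 0 mu i <= nth 0 la i /\ nth 0 la i.+1 <= nth 0 mu i)
    (interlace mu la).
Proof.
move=> sz; apply: (iffP allP) => [H i|H i _]; last by apply/andP/H.
have [il|li] := ltnP i (size la); first by apply/andP/H; rewrite mem_iota.
by rewrite !nth_default ?sz// ltnW.
Qed.

Lemma sumn_nth (s : seq nat) : sumn s = (\sum_(0 <= i < size s) nth 0 s i).
Proof. by rewrite sumnE (big_nth 0). Qed.

Lemma interlace_sumn mu la : size mu = size la -> interlace mu la ->
  (sumn mu <= sumn la).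
Proof.
move=> sz /(interlaceP sz) H; rewrite !sumn_nth sz; apply: leq_sum => i _.
by case: (H i).
Qed.

(** * Reflecting horizontal strips *)

Section Reflection.
Variables (m c : nat) (la mu : seq nat).
Hypotheses (lam : la \in box m) (mum : mu \in box m).

Let lo i := minn (nth 0 la i) (nth 0 mu i).
Let hi i := maxn (nth 0 la i) (nth 0 mu i).

(* A partition nu above la and mu has row i + 1 in the interval from hi (i + 1)
   to lo i, and this is also the range of row i of a partition below both. *)
Definition reflect_down (nu : seq nat) : seq nat :=
  mkseq (fun i => lo i + hi i.+1 - nth 0 nu i.+1) m.+1.

(** Row 0 of a partition above la and mu has no upper bound, so there is no interval to reflect it
    in: its excess c over the least possible value [hi 0] is prescribed. *)
Definition reflect_up (ka : seq nat) : seq nat :=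
  mkseq (fun i => if i is j.+1 then lo j + hi j.+1 - nth 0 ka j else hi 0 + c)
    m.+1.

Definition common_above nu :=
  [&& interlace la nu, interlace mu nu & nth 0 nu 0 == hi 0 + c].

(** The inequality says that the reflected partition, which has [sumn la + sumn mu + c - sumn ka]
    cells, fits into the box. *)
Definition common_below ka :=
  [&& interlace ka la, interlace ka mu
    & (sumn la + sumn mu + c <= m + sumn ka)].

Let lam' : size la = m.+1 /\ sumn la <= m.
Proof. by move: lam; rewrite mem_box => /andP[/eqP]. Qed.

Let mum' : size mu = m.+1 /\ sumn mu <= m.
Proof. by move: mum; rewrite mem_box => /andP[/eqP]. Qed.

Lemma sum_shift (h : nat -> nat) : h m.+1 = 0 ->
  (\sum_(0 <= i < m.+1) h i = h 0 + \sum_(0 <= i < m.+1) h i.+1).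
Proof. by move=> h0; rewrite big_nat_recl// [in RHS]big_nat_recr//= h0 addn0. Qed.

(* The rows lo i are weakly decreasing; if row m were nonzero, la would have at
   least m + 1 cells. *)
Lemma lo_last : (forall i, hi i.+1 <= lo i) -> forall i, m <= i -> lo i = 0.
Proof.
move=> H.
have lo_mono i j : i <= j -> lo j <= lo i.
  elim: j => [|j IHj]; first by rewrite leqn0 => /eqP ->.
  rewrite leq_eqVlt => /predU1P[->//|/IHj]; apply: leq_trans.
  by apply: leq_trans (H j); rewrite leq_max geq_minl.
move=> i mi; have [sz sm] := lam'.
suff: (m.+1 * lo i <= m) by case: (lo i) => // k; lia.
apply: leq_trans sm; rewrite sumn_nth sz.
rewrite -[X in (X * _)]subn0 -sum_nat_const_nat; rewrite !big_mkord.
apply: leq_sum => k _; apply: leq_trans (geq_minl (nth 0 la k) (nth 0 mu k)).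
by apply: lo_mono; apply: leq_trans mi; rewrite -ltnS.
Qed.

(** Add up the links over all rows: [lo i + hi i] is the sum of the rows i of la and mu, and the
    shifts of index cost only the first rows of nu and [hi], which differ by c. *)
Lemma sumn_linked ka nu : ka \in box m -> size nu = m.+1 ->
  nth 0 nu 0 = (hi 0 + c) ->
  (forall i, nth 0 ka i + nth 0 nu i.+1 = lo i + hi i.+1) ->
  (sumn ka + sumn nu = sumn la + sumn mu + c).
Proof.
rewrite mem_box => /andP[/eqP kasz _] nusz nu0 link.
have [lasz _] := lam'; have [musz _] := mum'.
rewrite !sumn_nth kasz nusz lasz musz (sum_shift (h := nth 0 nu)); last first.
  by rewrite nth_default// nusz.
rewrite nu0 addnCA -!big_split /=.
have -> : (\sum_(0 <= i < m.+1) (nth 0 la i + nth 0 mu i) =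
    \sum_(0 <= i < m.+1) lo i + \sum_(0 <= i < m.+1) hi i).
  by rewrite -big_split; apply: eq_bigr => i _ /=; rewrite addn_min_max.
rewrite (sum_shift (h := hi)); last by rewrite /hi !nth_default ?lasz ?musz.
under eq_bigr do rewrite link; rewrite big_split /=; lia.
Qed.

Lemma above_bounds nu : nu \in box m -> common_above nu ->
  [/\ forall i, (hi i <= nth 0 nu i), forall i, (nth 0 nu i.+1 <= lo i)
    & nth 0 nu 0 = hi 0 + c].
Proof.
rewrite mem_box => /andP[/eqP sz _] /and3P[].
move=> /interlaceP H1 /interlaceP H2 /eqP H3; split=> // i.
  by rewrite geq_max (H1 _ i).1 ?(H2 _ i).1 ?sz ?lam'.1 ?mum'.1.
by rewrite leq_min (H1 _ i).2 ?(H2 _ i).2 ?sz ?lam'.1 ?mum'.1.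
Qed.

Lemma below_bounds ka : ka \in box m -> common_below ka ->
  [/\ forall i, (hi i.+1 <= nth 0 ka i), forall i, (nth 0 ka i <= lo i)
    & (sumn la + sumn mu + c <= m + sumn ka)].
Proof.
rewrite mem_box => /andP[/eqP sz _] /and3P[].
move=> /interlaceP H1 /interlaceP H2 H3; split=> // i.
  by rewrite geq_max (H1 _ i).2 ?(H2 _ i).2 ?sz ?lam'.1 ?mum'.1.
by rewrite leq_min (H1 _ i).1 ?(H2 _ i).1 ?sz ?lam'.1 ?mum'.1.
Qed.

Lemma nth_reflect_down nu i : nu \in box m -> common_above nu ->
  (nth 0 (reflect_down nu) i + nth 0 nu i.+1 = lo i + hi i.+1).
Proof.
move=> nub /(above_bounds nub)[H1 H2 _].
have lo0 := lo_last (fun j => leq_trans (H1 j.+1) (H2 j)).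
have [im|mi] := ltnP i m.+1.
  by rewrite nth_mkseq//; move: (H1 i.+1) (H2 i); lia.
have := H2 i; have := H1 i.+1; have := lo0 i (ltnW mi).
by rewrite [nth _ (reflect_down nu) _]nth_default ?size_mkseq//; lia.
Qed.

(** The bounds on ka keep the subtraction from truncating. Row m + 1 is not stored, so the link at i
    = m needs [lo m] to be 0, which is [lo_last]. *)
Lemma nth_reflect_up ka i : ka \in box m -> common_below ka ->
  (nth 0 ka i + nth 0 (reflect_up ka) i.+1 = lo i + hi i.+1).
Proof.
move=> kab /(below_bounds kab)[H1 H2 _].
have lo0 := lo_last (fun j => leq_trans (H1 j) (H2 j)).
have [im|mi] := ltnP i m.
  by rewrite nth_mkseq//; move: (H1 i) (H2 i); lia.
have := H2 i; have := H1 i; have := lo0 i mi.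
by rewrite [X in (_ + X)]nth_default ?size_mkseq//; lia.
Qed.

Lemma sumn_reflect_down nu : nu \in box m -> common_above nu ->
  (sumn (reflect_down nu) + sumn nu = sumn la + sumn mu + c) /\
  reflect_down nu \in box m.
Proof.
move=> nub nua; have [H1 H2 H3] := above_bounds nub nua.
have link i := nth_reflect_down i nub nua.
have szd : size (reflect_down nu) = m.+1 by rewrite size_mkseq.
have bd : reflect_down nu \in box m.
  rewrite mem_box szd eqxx (leq_trans _ lam'.2)//.
  rewrite !sumn_nth szd lam'.1; apply: leq_sum => i _.
  move: (link i) (H1 i.+1) (geq_minl (nth 0 la i) (nth 0 mu i)).
  by rewrite /lo; lia.
split=> //; apply: sumn_linked => //.
by move: nub; rewrite mem_box => /andP[/eqP].
Qed.

Lemma sumn_reflect_up ka : ka \in box m -> common_below ka ->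
  (sumn ka + sumn (reflect_up ka) = sumn la + sumn mu + c) /\
  reflect_up ka \in box m.
Proof.
move=> kab kaa; have [H1 H2 H3] := below_bounds kab kaa.
have link i := nth_reflect_up i kab kaa.
have szu : size (reflect_up ka) = m.+1 by rewrite size_mkseq.
have E : (sumn ka + sumn (reflect_up ka) = sumn la + sumn mu + c).
  exact: sumn_linked.
by split=> //; rewrite mem_box szu eqxx; move: E H3; lia.
Qed.

(** Reflecting an interval twice is the identity, so [reflect_up] inverts [reflect_down]; the links
    turn the bounds on one partition into the interlacing of the other. *)
Lemma perm_reflect :
  perm_eq [seq ka <- box m | common_below ka]
          [seq reflect_down nu | nu <- [seq nu <- box m | common_above nu]].
Proof.
have inv nu : nu \in box m -> common_above nu ->
    reflect_up (reflect_down nu) = nu.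
  move=> nub nua; have [H1 H2 H3] := above_bounds nub nua.
  have nusz : size nu = m.+1 by move: nub; rewrite mem_box => /andP[/eqP].
  apply: (@eq_from_nth _ 0); first by rewrite size_mkseq.
  rewrite size_mkseq => -[|i] im; rewrite nth_mkseq// -(nth_reflect_down i nub nua).
  by rewrite addKn.
apply: uniq_perm.
- exact: filter_uniq (box_uniq m).
- rewrite map_inj_in_uniq ?(filter_uniq _ (box_uniq m))// => nu nu'.
  rewrite !(mem_filter common_above) => /andP[a b] /andP[a' b'] E.
  by rewrite -[LHS](inv nu b a) E inv.
move=> ka; rewrite (mem_filter common_below); apply/andP/mapP.
  move=> [kaa kab]; have [H1 H2 H3] := below_bounds kab kaa.
  have [E ub] := sumn_reflect_up kab kaa.
  have kasz : size ka = m.+1 by move: kab; rewrite mem_box => /andP[/eqP].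
  exists (reflect_up ka); last first.
    apply: (@eq_from_nth _ 0); first by rewrite size_mkseq.
    by move=> i; rewrite kasz => im; rewrite nth_mkseq// -(nth_reflect_up i kab kaa) addnK.
  rewrite (mem_filter common_above) ub andbT.
  have link i := nth_reflect_up i kab kaa.
  have N0 : nth 0 (reflect_up ka) 0 = (hi 0 + c) by [].
  rewrite /common_above N0 eqxx andbT; apply/andP; split; apply/interlaceP;
    rewrite ?size_mkseq ?lam'.1 ?mum'.1// => i; split.
  - case: i => [|i]; rewrite ?N0 /hi ?(leq_trans (leq_maxl _ _) (leq_addr _ _))//.
    by move: (link i) (H2 i) (leq_maxl (nth 0 la i.+1) (nth 0 mu i.+1)); rewrite /hi; lia.
  - by move: (link i) (H1 i) (geq_minl (nth 0 la i) (nth 0 mu i)); rewrite /lo; lia.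
  - case: i => [|i]; rewrite ?N0 /hi ?(leq_trans (leq_maxr _ _) (leq_addr _ _))//.
    by move: (link i) (H2 i) (leq_maxr (nth 0 la i.+1) (nth 0 mu i.+1)); rewrite /hi; lia.
  - by move: (link i) (H1 i) (geq_minr (nth 0 la i) (nth 0 mu i)); rewrite /lo; lia.
case=> nu; rewrite (mem_filter common_above) => /andP[nua nub] ->{ka}.
have [H1 H2 H3] := above_bounds nub nua.
have [E db] := sumn_reflect_down nub nua; split=> //.
have link i := nth_reflect_down i nub nua.
have nule : (sumn nu <= m) by move: nub; rewrite mem_box => /andP[].
apply/and3P; split; last by lia.
- apply/interlaceP; rewrite ?size_mkseq ?lam'.1// => i.
  move: (link i) (H1 i.+1) (H2 i) (geq_minl (nth 0 la i) (nth 0 mu i)).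
  by move: (leq_maxl (nth 0 la i.+1) (nth 0 mu i.+1)); rewrite /lo /hi; lia.
- apply/interlaceP; rewrite ?size_mkseq ?mum'.1// => i.
  move: (link i) (H1 i.+1) (H2 i) (geq_minr (nth 0 la i) (nth 0 mu i)).
  by move: (leq_maxr (nth 0 la i.+1) (nth 0 mu i.+1)); rewrite /lo /hi; lia.
Qed.

End Reflection.

(** A weight depending only on the number of cells is enough, because the powers of x and y in the
    commutation relation see nu only through its size. *)
Lemma sum_reflect (A : nmodType) (F : nat -> A) m c la mu :
  la \in box m -> mu \in box m ->
  (\sum_(nu <- box m | common_above c la mu nu) F (sumn nu) =
  \sum_(ka <- box m | common_below m c la mu ka)
    F (sumn la + sumn mu + c - sumn ka)%N)%R.
Proof.
move=> lam mum; rewrite -[RHS]big_filter.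
rewrite (perm_big _ (perm_reflect c lam mum)) big_map big_filter.
rewrite big_seq_cond [RHS]big_seq_cond; apply: eq_bigr => nu /andP[nub nua].
by have [<- _] := sumn_reflect_down lam mum nub nua; rewrite addKn.
Qed.

Local Open Scope mset_scope.
Local Open Scope ring_scope.

(** * Congruence of power series *)

Section Truncation.
Variables (V : choiceType) (R : comNzRingType) (M : {mset V}).
Implicit Types (f g h : fps V R) (N : {mset V}).

(** All divisors of M are included because the series vanishing on them form an ideal; agreement at
    M alone would not be stable under products. *)
Definition fps_eqmod f g := forall N, msubset N M -> f N = g N.

Definition fps_order (k : nat) f :=
  forall N, msubset N M -> (size N < k)%N -> f N = 0.

Lemma fps_addE f g N : (f + g) N = f N + g N.
Proof. by []. Qed.

Lemma fps_sumE I (r : seq I) (P : pred I) (F : I -> fps V R) N :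
  (\sum_(i <- r | P i) F i) N = \sum_(i <- r | P i) F i N.
Proof. exact: (big_morph (fun f : fps V R => f N)). Qed.

Lemma eqmod_refl f : fps_eqmod f f.
Proof. by []. Qed.

Lemma eqmod_eq f g : f = g -> fps_eqmod f g.
Proof. by move=> ->. Qed.

Lemma eqmod_sym f g : fps_eqmod f g -> fps_eqmod g f.
Proof. by move=> fg N NM; rewrite fg. Qed.

Lemma eqmod_trans g f h : fps_eqmod f g -> fps_eqmod g h -> fps_eqmod f h.
Proof. by move=> fg gh N NM; rewrite fg// gh. Qed.

Lemma eqmod_add f f' g g' :
  fps_eqmod f f' -> fps_eqmod g g' -> fps_eqmod (f + g) (f' + g').
Proof. by move=> ff gg N NM; rewrite !fps_addE ff// gg. Qed.

Lemma eqmod_mul f f' g g' :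
  fps_eqmod f f' -> fps_eqmod g g' -> fps_eqmod (f * g) (f' * g').
Proof.
by move=> ff gg N NM; apply: eq_fps_mul => N' N'N; [apply: ff|apply: gg];
  apply: msubset_trans NM.
Qed.

Lemma eqmod_opp f f' : fps_eqmod f f' -> fps_eqmod (- f) (- f').
Proof. by move=> ff N NM; rewrite -[LHS]/(- f N) ff. Qed.

Lemma eqmod_sum (I : eqType) (r : seq I) (P : pred I) (F G : I -> fps V R) :
  (forall i, i \in r -> P i -> fps_eqmod (F i) (G i)) ->
  fps_eqmod (\sum_(i <- r | P i) F i) (\sum_(i <- r | P i) G i).
Proof.
move=> FG N NM; rewrite !fps_sumE big_seq_cond [RHS]big_seq_cond.
by apply: eq_bigr => i /andP[ir Pi]; exact: FG.
Qed.

Lemma eqmod_sum0 (I : eqType) (r : seq I) (P : pred I) (F : I -> fps V R) :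
  (forall i, i \in r -> P i -> fps_eqmod (F i) 0) ->
  fps_eqmod (\sum_(i <- r | P i) F i) 0.
Proof. by move=> /eqmod_sum; rewrite big1_eq. Qed.

Lemma eqmod_prod1 (I : eqType) (r : seq I) (P : pred I) (F : I -> fps V R) :
  (forall i, i \in r -> P i -> fps_eqmod (F i) 1) ->
  fps_eqmod (\prod_(i <- r | P i) F i) 1.
Proof.
move=> F1; rewrite big_seq_cond; elim/big_rec: _ => // i f /andP[ir Pi] f1.
by rewrite -[X in fps_eqmod _ X]mulr1; apply: eqmod_mul => //; exact: F1.
Qed.

Lemma fps_order0 f : fps_order 0 f.
Proof. by []. Qed.

Lemma fps_order_mul j k f g :
  fps_order j f -> fps_order k g -> fps_order (j + k) (f * g).
Proof.
move=> fj gk N NM Njk.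
have H N' : msubset N' N -> N' \in mdivisors N by rewrite in_mdivisors.
rewrite -[LHS]/(fps_mul f g N) (fps_mulE _ _ H).
rewrite big_seq big1// => A; move: (A : {mset V}) => {}A; rewrite in_mdivisors => AN.
rewrite big_seq big1// => B; move: (B : {mset V}) => {}B; rewrite in_mdivisors => BN.
case: eqP => // ABN; have [Aj|jA] := ltnP (size A) j.
  by rewrite fj ?mul0r//; exact: msubset_trans NM.
rewrite [X in _ * X]gk ?mulr0//; first exact: msubset_trans NM.
by move: Njk; rewrite -ABN size_msetD; lia.
Qed.

Lemma fps_order_mull k f g : fps_order k g -> fps_order k (f * g).
Proof. exact: (@fps_order_mul 0). Qed.

Lemma fps_order_sum (I : eqType) (r : seq I) (P : pred I) (F : I -> fps V R) k :
  (forall i, i \in r -> P i -> fps_order k (F i)) ->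
  fps_order k (\sum_(i <- r | P i) F i).
Proof.
move=> Fk N NM Nk; rewrite fps_sumE big_seq_cond big1// => i /andP[ir Pi].
exact: Fk.
Qed.

Lemma fps_order_exp f k : fps_order 1 f -> fps_order k (f ^+ k).
Proof.
move=> f1; elim: k => [|k IHk]; first exact: fps_order0.
by rewrite exprS; exact: fps_order_mul f1 IHk.
Qed.

(** No divisor of M has larger degree than M. All truncation errors are discarded in this way. *)
Lemma eqmod0 k f : (size M < k)%N -> fps_order k f -> fps_eqmod f 0.
Proof.
move=> Mk fk N NM; rewrite fk//; apply: leq_ltn_trans Mk.
by have := size_msetD (M `\` N)%mset N; rewrite msetBDK// => ->; exact: leq_addl.
Qed.

(** * The operators adding and removing horizontal strips *)

Section Strips.
Variable m : nat.
Hypothesis size_le : (size M <= m)%N.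

(** The operator U(x), acting on a vector given by its coefficients [f mu]. *)
Definition add_strip (x : fps V R) (f : seq nat -> fps V R) la :=
  \sum_(mu <- box m | interlace mu la) x ^+ (sumn la - sumn mu) * f mu.

(** The adjoint operator D(y), in the same coordinates. *)
Definition remove_strip (y : fps V R) (f : seq nat -> fps V R) mu :=
  \sum_(la <- box m | interlace mu la) y ^+ (sumn la - sumn mu) * f la.

(** Group the partitions by the excess c of their first row over its least value; c is at most m
    since they lie in the box. *)
Lemma sum_common_above (F : nat -> fps V R) la mu :
  la \in box m -> mu \in box m ->
  \sum_(nu <- box m | interlace la nu && interlace mu nu) F (sumn nu) =
  \sum_(c < m.+1) \sum_(nu <- box m | common_above c la mu nu) F (sumn nu).
Proof.
move=> lam mum.
pose h := maxn (nth 0%N la 0) (nth 0%N mu 0).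
rewrite (partition_big (fun nu => inord (nth 0%N nu 0 - h) : 'I_m.+1) xpredT)//=.
apply: eq_bigr => c _; rewrite big_seq_cond [RHS]big_seq_cond.
apply: eq_bigl => nu.
have -> : common_above c la mu nu =
    (interlace la nu && interlace mu nu) && (nth 0%N nu 0 == h + c)%N.
  by rewrite /common_above andbA.
have [num|//] := boolP (nu \in box m); rewrite /=.
have [/andP[]|//] := boolP (interlace la nu && interlace mu nu).
move: lam mum (num); rewrite !mem_box => /andP[/eqP sl _] /andP[/eqP sm _].
move=> /andP[/eqP sn nule] /interlaceP H1 /interlaceP H2 /=.
have hle : (h <= nth 0%N nu 0)%N.
  by rewrite geq_max (H1 _ 0%N).1 ?(H2 _ 0%N).1 ?sn ?sl ?sm.
have nu0 := leq_trans (leq_nth_sumn nu 0) nule.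
have [cm /=] := ltn_ord c.
by rewrite -val_eqE /= inordK ?ltnS ?(leq_trans (leq_subr _ _))//; lia.
Qed.

(** By reflection, the partitions nu with excess c give [(x * y) ^+ c] times the terms of the
    partitions ka. Summing over c makes a geometric series, which the factor 1 - xy removes. *)
Lemma remove_add_strip x y (f : seq nat -> fps V R) mu :
  fps_order 1 x -> (forall la, la \in box m -> fps_order (sumn la) (f la)) ->
  mu \in box m ->
  fps_eqmod ((1 - x * y) * remove_strip y (add_strip x f) mu)
            (add_strip x (remove_strip y f) mu).
Proof.
move=> x1 fm mum.
pose z la ka := y ^+ (sumn la - sumn ka) * x ^+ (sumn mu - sumn ka) * f la.
pose below la := [pred ka | interlace ka la && interlace ka mu].
have -> : add_strip x (remove_strip y f) mu =
    \sum_(la <- box m) \sum_(ka <- box m | below la ka) z la ka.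
  rewrite /add_strip /remove_strip.
  transitivity (\sum_(ka <- box m | interlace ka mu)
      \sum_(la <- box m | interlace ka la) z la ka).
    apply: eq_bigr => ka _; rewrite mulr_sumr; apply: eq_bigr => la _.
    by rewrite mulrCA mulrA.
  rewrite (exchange_big_dep xpredT)//=; apply: eq_bigr => la _.
  by apply: eq_bigl => ka; rewrite andbC.
have H : fps_eqmod (remove_strip y (add_strip x f) mu)
    (\sum_(la <- box m) \sum_(c < m.+1) \sum_(ka <- box m | below la ka)
       (x * y) ^+ c * z la ka).
  apply: (@eqmod_trans (\sum_(la <- box m)
      \sum_(nu <- box m | interlace la nu && interlace mu nu)
      y ^+ (sumn nu - sumn mu) * x ^+ (sumn nu - sumn la) * f la)).
    apply: eqmod_eq.
    transitivity (\sum_(nu <- box m | interlace mu nu)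
      \sum_(la <- box m | interlace la nu)
        y ^+ (sumn nu - sumn mu) * x ^+ (sumn nu - sumn la) * f la).
      by apply: eq_bigr => nu _; rewrite mulr_sumr; apply: eq_bigr => la _; rewrite mulrA.
    rewrite (exchange_big_dep xpredT)//=; apply: eq_bigr => la _.
    by apply: eq_bigl => nu; rewrite andbC.
  apply: eqmod_sum => la lam _.
  (* The term of nu depends only on its size k, as [sum_reflect] requires. *)
  pose w k := y ^+ (k - sumn mu) * x ^+ (k - sumn la) * f la.
  rewrite (sum_common_above w)//; apply: eqmod_sum => c _ _.
  rewrite (sum_reflect w)// /w.
  rewrite big_mkcond [X in fps_eqmod _ X]big_mkcond.
  apply: eqmod_sum => ka kam _; rewrite /common_below /=.
  case: (boolP (interlace ka la)) => //= kala; case: (boolP (interlace ka mu)) => //= kamu.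
  have [szla szmu szka] : [/\ size la = m.+1, size mu = m.+1 & size ka = m.+1].
    move: lam mum kam; rewrite !mem_box.
    by move=> /andP[/eqP ? _] /andP[/eqP ? _] /andP[/eqP ? _].
  have kl := interlace_sumn (etrans szka (esym szla)) kala.
  have km := interlace_sumn (etrans szka (esym szmu)) kamu.
  case: ifP => cm.
    rewrite (_ : _ - sumn mu = c + (sumn la - sumn ka))%N; last by lia.
    rewrite (_ : _ - sumn la = c + (sumn mu - sumn ka))%N; last by lia.
    by apply: eqmod_eq; rewrite /z exprMn !exprD mulrACA !mulrA [_ ^+ c * _]mulrC.
  (* Here the reflection of ka has more than m cells, so it is missing from the box. Its term is
     negligible: the power of x and [f la] already give it an order equal to that number of
     cells. *)
  apply/eqmod_sym/(@eqmod0 (c + (sumn mu - sumn ka + sumn la))); first by lia.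
  rewrite exprMn /z -!mulrA; apply: fps_order_mul; first exact: fps_order_exp.
  do 2!apply: fps_order_mull.
  by apply: fps_order_mul; [exact: fps_order_exp|exact: fm].
refine (eqmod_trans (eqmod_mul (eqmod_refl _) H) _).
rewrite exchange_big /=.
under eq_bigr => c _ do under eq_bigr => la _ do rewrite -mulr_sumr.
under eq_bigr => c _ do rewrite -mulr_sumr.
rewrite -mulr_suml mulrA -/(fps_eqmod _ _) -[X in fps_eqmod _ X]mul1r.
apply: eqmod_mul => //.
(* The geometric sum telescopes to 1 - (xy)^(m+1), whose last power has order above the degree of
   M. *)
rewrite -(opprB (x * y)) mulNr -subrX1 opprB -[X in fps_eqmod _ X]subr0.
apply: eqmod_add => //; apply: eqmod_opp; apply: (@eqmod0 m.+1); first by [].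
by rewrite exprMn mulrC; apply: fps_order_mull; exact: fps_order_exp.
Qed.

(** The Schur function of la in the variables [xs]. The head of [xs] is applied last, so it belongs
    to the largest letter. *)
Definition schur_of (xs : seq (fps V R)) : seq nat -> fps V R :=
  foldr add_strip (fun la => (la == nseq m.+1 0%N)%:R) xs.

Lemma empty_in_box : nseq m.+1 0%N \in box m.
Proof. by rewrite mem_box size_nseq eqxx sumn_nseq. Qed.

Lemma interlace_empty mu : mu \in box m ->
  interlace mu (nseq m.+1 0%N) = (mu == nseq m.+1 0%N).
Proof.
rewrite mem_box => /andP[/eqP sz _]; have szE : size mu = size (nseq m.+1 0%N).
  by rewrite size_nseq.
apply/interlaceP/eqP => // [H|-> i]; last by rewrite !nth_nseq !if_same.
apply: (@eq_from_nth _ 0%N) => // i _; have [] := H i.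
by rewrite nth_nseq if_same leqn0 => /eqP.
Qed.

Lemma sum_at_empty (P : pred (seq nat)) (F : seq nat -> fps V R) :
  \sum_(la <- box m | P la) F la * (la == nseq m.+1 0%N)%:R =
  if P (nseq m.+1 0%N) then F (nseq m.+1 0%N) else 0.
Proof.
rewrite big_mkcond (bigD1_seq (nseq m.+1 0%N)) ?empty_in_box ?box_uniq//=.
rewrite eqxx mulr1 big1 ?addr0// => la /negPf ->.
by rewrite mulr0 if_same.
Qed.

Lemma schur_of_empty xs : schur_of xs (nseq m.+1 0%N) = 1.
Proof.
elim: xs => [|x xs IHxs] /=; first by rewrite eqxx.
rewrite /add_strip big_seq_cond (eq_bigl (pred1 (nseq m.+1 0%N))); last first.
  move=> mu /=; have [mum|mum] := boolP (mu \in box m).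
    by rewrite interlace_empty.
  by apply/esym/negP => /eqP E; rewrite E empty_in_box in mum.
rewrite -big_filter filter_pred1_uniq ?box_uniq ?empty_in_box// big_seq1.
by rewrite IHxs subnn mul1r.
Qed.

(** Each cell of la is added by one of the strips and contributes a factor of order 1. *)
Lemma schur_of_order xs la : (forall x, x \in xs -> fps_order 1 x) ->
  la \in box m -> fps_order (sumn la) (schur_of xs la).
Proof.
elim: xs la => [|x xs IHxs] la xs1 lam /=.
  case: eqP => [->|_] //; rewrite (_ : sumn _ = 0)//; exact: (sumn_nseq 0 m.+1).
apply: fps_order_sum => mu mum mula.
have mul : (sumn mu <= sumn la)%N.
  move: lam mum mula; rewrite !mem_box => /andP[/eqP sl _] /andP[/eqP sm _].
  by apply: interlace_sumn; rewrite sm.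
rewrite -[X in fps_order X](subnK mul); apply: fps_order_mul.
  by apply: fps_order_exp; apply: xs1; rewrite mem_head.
by apply: IHxs => // z zxs; apply: xs1; rewrite inE zxs orbT.
Qed.

(** D(y) is moved past the U(x) one at a time until it meets the empty partition, from which only
    the empty strip can be removed. *)
Lemma remove_schur_of xs y mu : (forall x, x \in xs -> fps_order 1 x) ->
  mu \in box m ->
  fps_eqmod (\prod_(x <- xs) (1 - x * y) * remove_strip y (schur_of xs) mu)
            (schur_of xs mu).
Proof.
elim: xs mu => [|x xs IHxs] mu xs1 mum.
  apply: eqmod_eq; rewrite big_nil mul1r /remove_strip /= sum_at_empty.
  rewrite interlace_empty//; case: eqP => // ->.
  by rewrite subnn expr0.
have xs1' z : z \in xs -> fps_order 1 z.
  by move=> zxs; apply: xs1; rewrite inE zxs orbT.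
rewrite big_cons [_ * \prod_(_ <- _) _]mulrC -mulrA /=.
refine (eqmod_trans (eqmod_mul (eqmod_refl _) (remove_add_strip y _ _ mum)) _).
- by apply: xs1; rewrite mem_head.
- by move=> la lam; exact: schur_of_order.
rewrite /add_strip mulr_sumr; apply: eqmod_sum => la lam _.
by rewrite mulrCA; apply: eqmod_mul => //; exact: IHxs.
Qed.

(** Induction on [ys]: by adjointness the outermost U(y) becomes a D(y) on the other Schur function,
    where the factors 1 - xy absorb it. *)
Lemma truncated_cauchy xs ys : (forall x, x \in xs -> fps_order 1 x) ->
  fps_eqmod (\prod_(y <- ys) \prod_(x <- xs) (1 - x * y) *
             \sum_(la <- box m) schur_of xs la * schur_of ys la) 1.
Proof.
move=> xs1; elim: ys => [|y ys IHys].
  by rewrite big_nil mul1r /= sum_at_empty schur_of_empty.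
suff E : fps_eqmod (\prod_(x <- xs) (1 - x * y) *
    \sum_(la <- box m) schur_of xs la * schur_of (y :: ys) la)
    (\sum_(la <- box m) schur_of xs la * schur_of ys la).
  rewrite big_cons [_ * \prod_(_ <- ys) _]mulrC -mulrA.
  exact: (eqmod_trans (eqmod_mul (eqmod_refl _) E) IHys).
(* D(y) is adjoint to U(y) for the pairing that sums products of coefficients. *)
have -> : \sum_(la <- box m) schur_of xs la * schur_of (y :: ys) la =
    \sum_(mu <- box m) remove_strip y (schur_of xs) mu * schur_of ys mu.
  transitivity (\sum_(la <- box m) \sum_(mu <- box m | interlace mu la)
      y ^+ (sumn la - sumn mu) * schur_of xs la * schur_of ys mu).
    apply: eq_bigr => la _; rewrite /= mulr_sumr; apply: eq_bigr => mu _.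
    by rewrite mulrCA mulrA.
  rewrite (exchange_big_dep xpredT)//=; apply: eq_bigr => mu _.
  by rewrite mulr_suml.
rewrite mulr_sumr; apply: eqmod_sum => mu mum _.
by rewrite mulrA; apply: eqmod_mul => //; exact: remove_schur_of.
Qed.

End Strips.
End Truncation.

(** * Dotted tableaux as chains of partitions *)

Lemma allpairs_cons_uniq (T : eqType) (s : seq T) (t : seq (seq T)) :
  uniq s -> uniq t -> uniq [seq x :: y | x <- s, y <- t].
Proof. by move=> us ut; apply: allpairs_uniq => // -[? ?] [? ?] _ _ [-> ->]. Qed.

Lemma nth_shape_size (S : Type) (s : seq (seq S)) i :
  nth 0%N (shape s) i = size (nth [::] s i).
Proof.
have [il|li] := ltnP i (size s); first by rewrite (nth_map [::]).
by rewrite !nth_default// size_map.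
Qed.

(** * Choices of dots *)

Section Words.
Variable n : nat.

Fixpoint words (d : nat) : seq (seq 'I_n) :=
  if d is d'.+1 then [seq k :: w | k <- enum 'I_n, w <- words d'] else [:: [::]].

Lemma mem_words d w : (w \in words d) = (size w == d).
Proof.
elim: d w => [|d IHd] w /=; first by rewrite inE size_eq0.
apply/allpairsP/eqP => [[[k v] /= [_ + ->]]|]; first by rewrite IHd /= => /eqP ->.
case: w => // k w [wd]; exists (k, w); split=> //=; first by rewrite mem_enum.
by rewrite IHd wd.
Qed.

Lemma words_uniq d : uniq (words d).
Proof. by elim: d => //= d IHd; rewrite allpairs_cons_uniq// enum_uniq. Qed.

Fixpoint blocks (ds : seq nat) : seq (seq (seq 'I_n)) :=
  if ds is d :: ds' then [seq w :: W | w <- words d, W <- blocks ds'] else [:: [::]].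

Lemma mem_blocks ds W : (W \in blocks ds) = (shape W == ds).
Proof.
elim: ds W => [|d ds IHds] W /=; first by rewrite inE; case: W.
apply/allpairsP/eqP => [[[w U] /= [+ + ->]]|].
  by rewrite mem_words IHds /= => /eqP -> /eqP ->.
case: W => // w W [wd Wds]; exists (w, W).
by rewrite mem_words IHds wd Wds !eqxx.
Qed.

Lemma blocks_uniq ds : uniq (blocks ds).
Proof. by elim: ds => //= d ds IHds; rewrite allpairs_cons_uniq// words_uniq. Qed.

Lemma sum_words (A : comNzRingType) (g : 'I_n -> A) d :
  \sum_(w <- words d) \prod_(k <- w) g k = (\sum_k g k) ^+ d.
Proof.
elim: d => [|d IHd] /=; first by rewrite big_seq1 big_nil.
rewrite big_allpairs_dep exprS -IHd mulr_suml big_enum /=; apply: eq_bigr => k _.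
by rewrite mulr_sumr; apply: eq_bigr => w _; rewrite big_cons.
Qed.

(** The dots of the cells of a strip are chosen independently, so all choices together give one
    power of the sum of the variables. *)
Lemma sum_blocks (A : comNzRingType) (g : 'I_n -> A) ds :
  \sum_(W <- blocks ds) \prod_(k <- flatten W) g k = (\sum_k g k) ^+ sumn ds.
Proof.
elim: ds => [|d ds IHds] /=; first by rewrite big_seq1 big_nil.
rewrite big_allpairs_dep exprD -IHds -sum_words mulr_suml; apply: eq_bigr => w _.
by rewrite mulr_sumr; apply: eq_bigr => W _; rewrite big_cat.
Qed.

End Words.

Section Tableaux.
Variables (n m : nat).
Implicit Types (T : seq (seq (letter n))) (la mu : seq nat) (r : seq (letter n)).

Definition below (N : nat) : pred (letter n) := fun a => (a.1 < N)%N.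

Definition glue (N : nat) (TW : seq (seq (letter n)) * seq (seq 'I_n)) :=
  [seq p.1 ++ [seq (N, k) | k <- p.2] | p <- zip TW.1 TW.2].

Definition skew la mu : seq nat := [seq (p.1 - p.2)%N | p <- zip la mu].

(** Follows the recursion of [schur_of]: the letters below N' fill a partition mu, the letters N'
    fill the strip la/mu, and their dots W are arbitrary. *)
Fixpoint tabs (N : nat) la : seq (seq (seq (letter n))) :=
  if N is N'.+1 then
    [seq glue N' TW | mu <- [seq mu <- box m | interlace mu la],
                      TW <- [seq (T, W) | T <- tabs N' mu, W <- blocks n (skew la mu)]]
  else if la == nseq m.+1 0%N then [:: nseq m.+1 [::]] else [::].

(* The inequalities say that the partitions formed by the entries below 1, 2, ...
   interlace; for weakly increasing rows this amounts to strict columns. *)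
Definition bounded_tableau (N : nat) T : Prop :=
  [/\ forall i, sorted (@letter_le n) (nth [::] T i),
      forall i, all (below N) (nth [::] T i)
    & forall i j, (count (below j.+1) (nth [::] T i.+1) <=
                   count (below j) (nth [::] T i))%N].

Lemma letter_leE (a b : letter n) : letter_le a b = (a.1 <= b.1)%N.
Proof. by rewrite /letter_le /letter_lt -leqNgt. Qed.

Lemma letter_le_trans : transitive (@letter_le n).
Proof. by move=> b a c; rewrite !letter_leE; exact: leq_trans. Qed.

Lemma nth_glue N T (W : seq (seq 'I_n)) i : size T = size W ->
  nth [::] (glue N (T, W)) i =
  nth [::] T i ++ [seq (N, k) | k <- nth [::] W i].
Proof.
move=> sz; have [iT|Ti] := ltnP i (size T); last first.
  by rewrite !nth_default -?sz// size_map size_zip -sz minnn.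
rewrite (nth_map ([::], [::])) ?size_zip -?sz ?minnn//.
by rewrite nth_zip.
Qed.

Lemma size_glue N T (W : seq (seq 'I_n)) : size T = size W ->
  size (glue N (T, W)) = size T.
Proof. by move=> sz; rewrite size_map size_zip -sz minnn. Qed.

Lemma size_skew la mu : size la = size mu -> size (skew la mu) = size la.
Proof. by move=> sz; rewrite size_map size_zip -sz minnn. Qed.

Lemma nth_skew la mu i : size la = size mu ->
  nth 0%N (skew la mu) i = (nth 0%N la i - nth 0%N mu i)%N.
Proof.
move=> sz; have [il|li] := ltnP i (size la); last first.
  by rewrite !nth_default// ?size_skew// -sz.
by rewrite (nth_map (0, 0)%N) ?size_zip -?sz ?minnn// nth_zip.
Qed.

Lemma sumn_skew la mu : size mu = size la -> interlace mu la ->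
  sumn (skew la mu) = (sumn la - sumn mu)%N.
Proof.
move=> sz /(interlaceP sz) H.
rewrite !sumn_nth size_skew// sz -sumnB; last by move=> i _; case: (H i).
by apply: eq_bigr => i _; rewrite nth_skew.
Qed.

Lemma count_below_map N j (w : seq 'I_n) :
  count (below j) [seq (N, k) | k <- w] = if (N < j)%N then size w else 0%N.
Proof. by rewrite count_map; elim: w => [|k w /= ->] /=; rewrite /below /=; case: ifP. Qed.

Lemma count_below_filter N j r :
  count (below j) [seq a <- r | below N a] = count (below (minn j N)) r.
Proof.
by rewrite count_filter; apply: eq_count => a; rewrite /= /below leq_min.
Qed.

Lemma count_below_mono i j r : (i <= j)%N -> (count (below i) r <= count (below j) r)%N.
Proof. by move=> ij; apply: sub_count => a; rewrite /below => /leq_trans; apply. Qed.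

(** The letters of value N are the largest ones, so they end the row; as they are incomparable with
    each other, their dots can form any word. *)
Lemma sorted_split N r : sorted (@letter_le n) r -> all (below N.+1) r ->
  r = [seq a <- r | below N a] ++
      [seq (N, k) | k <- [seq a.2 | a <- r & ~~ below N a]].
Proof.
elim: r => //= a r IHr; rewrite path_sortedE; last exact: letter_le_trans.
move=> /andP[ar rs] /andP[aN rN]; case: ifPn => aN' /=; first by congr cons; exact: IHr.
have aE : a.1 = N by apply/eqP; move: aN aN'; rewrite /below; lia.
have E0 : [seq b <- r | below N b] = [::].
  apply/eqP; rewrite -[_ == _]negbK -has_filter -all_predC; apply/allP => b br /=.
  by have := allP ar b br; rewrite letter_leE /below aE -leqNgt.
by have := IHr rs rN; rewrite E0 /= -aE -surjective_pairing => <-.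
Qed.

Definition entries_below (N : nat) T := [seq [seq a <- r | below N a] | r <- T].

Definition entries_from (N : nat) T : seq (seq 'I_n) :=
  [seq [seq a.2 | a <- r & ~~ below N a] | r <- T].

Lemma nth_entries_below N T i :
  nth [::] (entries_below N T) i = [seq a <- nth [::] T i | below N a].
Proof.
have [iT|Ti] := ltnP i (size T); first by rewrite (nth_map [::]).
by rewrite !nth_default// size_map.
Qed.

Lemma nth_entries_from N T i :
  nth [::] (entries_from N T) i = [seq a.2 | a <- nth [::] T i & ~~ below N a].
Proof.
have [iT|Ti] := ltnP i (size T); first by rewrite (nth_map [::]).
by rewrite !nth_default// size_map.
Qed.

Lemma glue_entries N T : bounded_tableau N.+1 T ->
  glue N (entries_below N T, entries_from N T) = T.
Proof.
case=> srt bnd _; have sz : size (entries_below N T) = size (entries_from N T).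
  by rewrite !size_map.
apply: (@eq_from_nth _ [::]); first by rewrite size_glue// size_map.
move=> i _; rewrite nth_glue// nth_entries_below nth_entries_from.
by rewrite -sorted_split.
Qed.

Lemma entries_glue N T (W : seq (seq 'I_n)) :
  size T = size W -> bounded_tableau N T ->
  entries_below N (glue N (T, W)) = T /\ entries_from N (glue N (T, W)) = W.
Proof.
move=> sz [_ bnd _]; split.
  apply: (@eq_from_nth _ [::]); first by rewrite size_map size_glue.
  move=> i _; rewrite nth_entries_below nth_glue// filter_cat.
  rewrite (all_filterP (bnd i)) filter_map (eq_filter (a2 := pred0)) ?filter_pred0 ?cats0//.
  by move=> k; exact: ltnn.
apply: (@eq_from_nth _ [::]); first by rewrite size_map size_glue.
move=> i _; rewrite nth_entries_from nth_glue// filter_cat filter_map.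
rewrite (eq_in_filter (a2 := pred0)) ?filter_pred0; last first.
  by move=> a /(allP (bnd i)) /= ->.
rewrite (eq_filter (a2 := xpredT)) ?filter_predT; last first.
  by move=> k /=; rewrite /below /= ltnn.
by rewrite /= -map_comp map_id.
Qed.

(** In row i the number of entries below j is that of T for j at most N, and the whole row of la
    beyond. The inequalities thus come from T for j < N, from the interlacing for j = N, and from la
    being decreasing for j > N. *)
Lemma bounded_tableau_glue N T (W : seq (seq 'I_n)) la :
  size T = size W -> size la = size T ->
  bounded_tableau N T -> interlace (shape T) la -> shape W = skew la (shape T) ->
  shape (glue N (T, W)) = la /\ bounded_tableau N.+1 (glue N (T, W)).
Proof.
move=> szW szla [srt bnd strict] /interlaceP H skewW.
have szs : size (shape T) = size la by rewrite size_map szla.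
have {}H := H szs.
have shE : shape (glue N (T, W)) = la.
  apply: (@eq_from_nth _ 0%N); first by rewrite size_map size_glue.
  move=> i _; rewrite nth_shape_size nth_glue// size_cat size_map.
  rewrite -!nth_shape_size skewW nth_skew//.
  by rewrite subnKC//; case: (H i).
have rowN i : size (nth [::] (glue N (T, W)) i) = nth 0%N la i.
  by rewrite -nth_shape_size shE.
have cntN j i : (N < j)%N -> count (below j) (nth [::] (glue N (T, W)) i) = nth 0%N la i.
  move=> Nj; rewrite -rowN nth_glue// count_cat size_cat count_below_map Nj size_map.
  congr (_ + _)%N; apply/eqP; rewrite -all_count; apply: sub_all (bnd i) => a.
  by rewrite /below => /ltn_trans; apply.
have cntT j i : (j <= N)%N ->
    count (below j) (nth [::] (glue N (T, W)) i) = count (below j) (nth [::] T i).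
  by move=> jN; rewrite nth_glue// count_cat count_below_map ltnNge jN addn0.
split=> //; split=> [i|i|i j].
- rewrite nth_glue// (sorted_pairwise letter_le_trans) pairwise_cat.
  rewrite -!(sorted_pairwise letter_le_trans) srt andbC /=; apply/andP; split.
    elim: (nth [::] W i) => //= k [|l w] //= ->.
    by rewrite letter_leE /= leqnn.
  apply/allrelP => a b /(allP (bnd i)); rewrite /below => aN /mapP[k _ ->].
  by rewrite letter_leE ltnW.
- rewrite nth_glue// all_cat; apply/andP; split.
    by apply: sub_all (bnd i) => a; rewrite /below => /ltnW; rewrite ltnS.
  by rewrite all_map; apply/allP => k _; rewrite /= /below /=.
- have [jN|Nj] := ltnP j N; first by rewrite !cntT// ltnW.
  rewrite cntN ?ltnS//; move: Nj; rewrite leq_eqVlt => /predU1P[<-|Nj].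
    rewrite cntT//; have := (H i).2; rewrite nth_shape_size => /leq_trans; apply.
    by rewrite -(eqP (etrans (esym (all_count _ _)) (bnd i))).
  by rewrite cntN//; have [] := H i; lia.
Qed.

(** The interlacing is the inequality for j = N, since all entries of T are below N + 1. *)
Lemma bounded_tableau_entries N T : bounded_tableau N.+1 T ->
  bounded_tableau N (entries_below N T) /\
  interlace (shape (entries_below N T)) (shape T).
Proof.
case=> srt bnd strict; split; last first.
  apply/interlaceP => [|i]; first by rewrite !size_map.
  rewrite !nth_shape_size nth_entries_below size_filter count_size; split=> //.
  have := strict i N; apply: leq_trans.
  by rewrite -(eqP (etrans (esym (all_count _ _)) (bnd i.+1))).
split=> [i|i|i j]; rewrite !nth_entries_below.
- by apply: (sorted_filter letter_le_trans); exact: srt.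
- exact: filter_all.
rewrite !count_below_filter.
have [jN|Nj] := leqP j.+1 N; first by rewrite (minn_idPl (ltnW jN)).
rewrite (minn_idPr _)//; apply: leq_trans (strict i N).
by apply: count_below_mono.
Qed.

Lemma mem_tabs N la T : la \in box m ->
  (T \in tabs N la) <-> shape T = la /\ bounded_tableau N T.
Proof.
elim: N la T => [|N IHN] la T lam /=.
  split.
    case: eqP => // ->; rewrite inE => /eqP ->; split.
      by rewrite /= /shape map_nseq.
    have E0 i : nth [::] (nseq m.+1 [::]) i = [::] :> seq (letter n).
      by rewrite nth_nseq if_same.
    by split=> [i|i|i j]; rewrite !E0.
  case=> Tla [_ bnd _].
  have T0 i : nth [::] T i = [::].
    by move: (bnd i); case: (nth [::] T i).
  move: lam; rewrite mem_box => /andP[/eqP sla _].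
  have szT : size T = m.+1 by rewrite -sla -Tla size_map.
  have -> : T = nseq m.+1 [::].
    apply: (@eq_from_nth _ [::]); first by rewrite size_nseq.
    by move=> i _; rewrite T0 nth_nseq if_same.
  have -> : la = nseq m.+1 0%N.
    apply: (@eq_from_nth _ 0%N); first by rewrite size_nseq.
    by move=> i _; rewrite -Tla nth_shape_size T0 nth_nseq if_same.
  by rewrite eqxx mem_head.
move: (lam); rewrite mem_box => /andP[/eqP sla lale]; split.
  case/allpairsPdep => mu [_ [+ /allpairsP[[T' W] [T'mu Wmu ->]] ->]].
  rewrite (mem_filter (fun mu => interlace mu la)) => /andP[mula mum].
  have [T'mu' T'b] := (IHN mu T' mum).1 T'mu.
  move: Wmu; rewrite mem_blocks /= => /eqP Wmu.
  move: (mum); rewrite mem_box => /andP[/eqP smu _].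
  have sT : size T' = m.+1 by rewrite -smu -T'mu' size_map.
  have sW : size W = m.+1.
    by rewrite -[RHS]sla -(@size_skew la mu) ?sla ?smu// -Wmu size_map.
  by apply: bounded_tableau_glue; rewrite ?T'mu'// ?sT ?sW ?sla.
case=> Tla Tb; have [Eb] := bounded_tableau_entries Tb; rewrite Tla.
set mu := shape _ => mula.
have sT : size T = m.+1 by rewrite -sla -Tla size_map.
have smu : size mu = m.+1 by rewrite !size_map.
have mum : mu \in box m.
  rewrite mem_box smu eqxx (leq_trans _ lale)//.
  by rewrite interlace_sumn// sla.
apply/allpairsPdep; exists mu, (entries_below N T, entries_from N T); split.
- by rewrite (mem_filter (fun mu => interlace mu la)) mula.
- apply/allpairsP; exists (entries_below N T, entries_from N T); split=> //=.
    exact/(IHN mu _ mum).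
  rewrite mem_blocks; apply/eqP/(@eq_from_nth _ 0%N).
    by rewrite size_skew ?sla ?smu// !size_map.
  move=> i _; rewrite nth_shape_size nth_skew ?sla ?smu// -Tla.
  rewrite !nth_shape_size nth_entries_below nth_entries_from size_map !size_filter.
  by rewrite -(count_predC (below N)) addKn.
- by rewrite glue_entries.
Qed.

Lemma tabs_uniq N la : la \in box m -> uniq (tabs N la).
Proof.
elim: N la => [|N IHN] la lam /=; first by case: ifP.
apply: allpairs_uniq_dep.
- exact: filter_uniq (box_uniq m).
- move=> mu; rewrite (mem_filter (fun mu => interlace mu la)) => /andP[_ mum].
  rewrite allpairs_uniq ?blocks_uniq//; first exact: IHN.
  by move=> [? ?] [? ?] _ _ [-> ->].
(* Separating the letters N from the smaller ones recovers T and W, and mu is the shape of T. *)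
have inv mu TW : mu \in [seq mu <- box m | interlace mu la] ->
    TW \in [seq (T, W) | T <- tabs N mu, W <- blocks n (skew la mu)] ->
    entries_below N (glue N TW) = TW.1 /\ entries_from N (glue N TW) = TW.2
    /\ mu = shape TW.1.
  rewrite (mem_filter (fun mu => interlace mu la)) => /andP[mula mum].
  case/allpairsP => -[T W] [/= Tmu Wmu ->] /=.
  have [Tmu' Tb] := (mem_tabs N T mum).1 Tmu.
  move: Wmu; rewrite mem_blocks /= => /eqP Wmu.
  move: lam mum; rewrite !mem_box => /andP[/eqP sla _] /andP[/eqP smu _].
  have sT : size T = m.+1 by rewrite -smu -Tmu' size_map.
  have sW : size W = m.+1.
    by rewrite -[RHS]sla -(@size_skew la mu) ?sla ?smu// -Wmu size_map.
  by have [] := @entries_glue N T W (etrans sT (esym sW)) Tb.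
move=> _ _ /allpairsPdep[mu [TW [mum TWmu ->]]]
  /allpairsPdep[mu' [TW' [mum' TWmu' ->]]] /= E.
have [b1 [f1 s1]] := inv mu TW mum TWmu.
have [b2 [f2 s2]] := inv mu' TW' mum' TWmu'.
have TWE : TW = TW'.
  by rewrite [TW]surjective_pairing [TW']surjective_pairing -b1 -f1 -b2 -f2 E.
by rewrite s1 s2 TWE.
Qed.

(** By [sum_blocks] both sides obey the same recursion on N. The list is reversed because the strip
    of the largest letter is added last. *)
Lemma sum_tabs (V : choiceType) (R : comNzRingType) (z : letter n -> fps V R) N la :
  la \in box m ->
  \sum_(T <- tabs N la) \prod_(a <- flatten T) z a =
  schur_of m [seq \sum_k z (i, k) | i <- rev (iota 0 N)] la.
Proof.
elim: N la => [|N IHN] la lam.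
  rewrite /=; case: eqP => _; rewrite ?big_nil// big_seq1.
  by elim: m => [|k IHk] /=; rewrite ?big_nil.
rewrite -addn1 iotaD rev_cat /= add0n addn1 big_allpairs_dep /add_strip.
rewrite -[RHS]big_filter big_seq [RHS]big_seq; apply: eq_bigr => mu.
rewrite (mem_filter (fun mu => interlace mu la)) => /andP[mula mum].
move: (lam) (mum); rewrite !mem_box => /andP[/eqP sla _] /andP[/eqP smu _].
rewrite -IHN// mulrC -sumn_skew ?sla ?smu// -sum_blocks big_allpairs_dep mulr_suml.
rewrite big_seq [RHS]big_seq; apply: eq_bigr => T Tmu.
rewrite mulr_sumr big_seq [RHS]big_seq; apply: eq_bigr => W; rewrite mem_blocks => /eqP Wmu.
have [Tmu' _] := (mem_tabs N T mum).1 Tmu.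
have szTW : size T = size W.
  rewrite -(size_map size T) -/(shape T) Tmu' -(size_map size W) -/(shape W).
  by rewrite Wmu size_skew ?sla.
rewrite !big_flatten /= /glue big_map /=.
elim: T W szTW {Tmu Tmu' Wmu} => [|r T IHT] [|w W] //=.
  by rewrite !big_nil mulr1.
case=> /IHT E; rewrite !big_cons E big_cat big_map /=.
by rewrite mulrACA.
Qed.

End Tableaux.

(** * Strict columns as interlacing *)

Section Columns.
Variable n : nat.
Implicit Types (T : seq (seq (letter n))) (la : seq nat) (r : seq (letter n)).

Lemma column_cons r T c :
  column (r :: T) c = oapp (fun a => a :: column T c) (column T c) (onth r c).
Proof. by rewrite /column /=; case: onth. Qed.

Lemma column_nil T c : all (fun r => size r <= c)%N T -> column T c = [::].
Proof.
elim: T => // r T IHT; rewrite column_cons => /andP[rc Tc]; rewrite IHT//.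
by rewrite onth_default.
Qed.

Lemma onth_unzip1 r c a : onth r c = Some a -> nth 0%N (unzip1 r) c = a.1.
Proof. by elim: r c => [|b r IHr] [|c] //= => [[->]|/IHr]. Qed.

(** Rows of weakly decreasing length leave no gaps in a column, so its consecutive entries lie in
    adjacent rows. *)
Lemma columns_strictP T : sorted geq (shape T) ->
  (forall c, sorted (@letter_lt n) (column T c)) <->
  (forall i c, c < size (nth [::] T i.+1) ->
     nth 0 (unzip1 (nth [::] T i)) c < nth 0 (unzip1 (nth [::] T i.+1)) c)%N.
Proof.
elim: T => [|r T IHT] Tgeq.
  by split=> // _ i c; rewrite !nth_nil.
have {}IHT := IHT (path_sorted Tgeq).
case: T => [|r' T] in Tgeq IHT *.
  split=> [_ i c|_ c]; first by rewrite /= nth_nil.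
  by rewrite column_cons; case: onth.
have /andP[rr' T'geq] := Tgeq.
have col_nil c : (size r' <= c)%N -> column (r' :: T) c = [::].
  move=> rc; apply: column_nil => /=; rewrite rc /=.
  have := order_path_min geq_trans T'geq; rewrite all_map; apply: sub_all => u /=.
  by move=> /leq_trans; apply.
have step c : (c < size r')%N -> sorted (@letter_lt n) (column (r :: r' :: T) c) =
    (nth 0 (unzip1 r) c < nth 0 (unzip1 r') c)%N &&
    sorted (@letter_lt n) (column (r' :: T) c).
  move=> cr'; rewrite !column_cons.
  have := onthTE r c; have := onthTE r' c; rewrite cr' (leq_trans cr' rr').
  case E' : (onth r' c) => [b|//] _; case E : (onth r c) => [a|//] _ /=.
  by rewrite (onth_unzip1 E) (onth_unzip1 E').
split=> [H|H c].
  have [H1 _] := IHT; case=> [|i] c /= cr'; last first.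
    apply: H1 => // c'; have := H c'; rewrite column_cons.
    by case: (onth r c') => // a; exact: path_sorted.
  by have := H c; rewrite step// => /andP[].
have H2 : sorted (@letter_lt n) (column (r' :: T) c).
  by have [_ ->] := IHT => // i; exact: (H i.+1).
have [cr'|r'c] := ltnP c (size r'); first by rewrite step// H2 andbT (H 0%N).
by rewrite column_cons col_nil//; case: onth.
Qed.

(** The entries below j are an initial segment of a weakly increasing row. *)
Lemma ltn_count_below j r c : sorted (@letter_le n) r ->
  (c < count (below j) r)%N = (c < size r)%N && (nth 0 (unzip1 r) c < j)%N.
Proof.
elim: r c => [|a r IHr] c //=; rewrite path_sortedE; last exact: letter_le_trans.
move=> /andP[ar rs]; have [aj|ja] := boolP (below j a).
  by case: c => [|c] /=; rewrite ?add1n ?ltnS ?IHr.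
have r0 : count (below j) r = 0%N.
  apply/eqP; rewrite -leqn0 leqNgt -has_count -all_predC; apply/allP => b br /=.
  move: (allP ar b br) ja; rewrite letter_leE /below -!leqNgt => ab ja.
  exact: leq_trans ab.
rewrite r0; case: c => [|c] /=; first exact/esym/negbTE.
by rewrite ltnS -IHr// r0.
Qed.

Lemma dotted_tableauP N la mu T : sorted geq la ->
  (dotted_tableau la mu T /\ all (below N) (flatten T)) <->
  [/\ shape T = la, bounded_tableau N T
    & forall k, count (fun a : letter n => a.2 == k) (flatten T) = mu k].
Proof.
move=> lageq.
have rowsP (p : pred (seq (letter n))) : p [::] ->
    (forall r, r \in T -> p r) <-> forall i, p (nth [::] T i).
  move=> p0; split=> [H i|H r]; last by case/(nthP [::]) => i _ <-.
  have [iT|Ti] := ltnP i (size T); first by apply/H/mem_nth.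
  by rewrite nth_default.
have allP' : all (below N) (flatten T) <-> forall i, all (below N) (nth [::] T i).
  have -> : all (below N) (flatten T) = all (all (below N)) T.
    by elim: (T) => //= r T' IHT; rewrite all_cat IHT.
  have [H1 H2] := rowsP (all (below N)) isT.
  by split=> [/allP|/H2 /allP].
have [s1 s2] := rowsP (sorted (@letter_le n)) isT.
have sizeP i : shape T = la -> (size (nth [::] T i.+1) <= size (nth [::] T i))%N.
  move=> Tla; rewrite -!nth_shape_size Tla.
  have [il|li] := ltnP i.+1 (size la); last by rewrite nth_default.
  exact: (sortedP 0%N lageq).
split.
  case=> -[Tla srt /columns_strictP strict mulT] /allP' bnd; split=> //.
  have {}srt := s1 srt; rewrite Tla in strict; have {}strict := strict lageq.
  split=> // i j; rewrite leqNgt; apply/negP => lt_c.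
  move: (lt_c); rewrite ltn_count_below// => /andP[ci].
  (* If the inequality fails, take for the column the number of entries below j in row i. There row
     i has an entry at least j and row i + 1 one at most j, against strictness. *)
  have := ltnn (count (below j) (nth [::] T i)).
  rewrite ltn_count_below//; case: ltnP => /= [_|]; last first.
    by rewrite leqNgt (leq_trans ci (sizeP _ Tla)).
  have := strict i _ ci; lia.
case=> Tla [srt bnd strict] mulT; split; last exact/allP'.
split=> //; first exact: s2.
apply/columns_strictP; first by rewrite Tla.
move=> i c ci; have [_|] := boolP (c < size (nth [::] T i))%N; last first.
  by rewrite (leq_trans ci (sizeP i Tla)).
(* With j the entry of row i + 1 in column c, the inequality puts position c of row i among the
   entries below j. *)
pose j := nth 0%N (unzip1 (nth [::] T i.+1)) c.
have : (c < count (below j.+1) (nth [::] T i.+1))%N.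
  by rewrite ltn_count_below// ci ltnSn.
by move/leq_trans => /(_ _ (strict i j)); rewrite ltn_count_below// => /andP[].
Qed.

End Columns.

(** * Partitions without zero parts *)

Section Padding.
Variable m : nat.
Implicit Types la : seq nat.

Definition pad la : seq nat := la ++ nseq (m.+1 - size la) 0%N.

Lemma size_partition d la : is_partition d la -> (size la <= d)%N.
Proof.
case=> _ + <-; elim: la => //= a la IHla.
rewrite inE eq_sym negb_or -lt0n => /andP[a0 /IHla].
exact: leq_add a0.
Qed.

Lemma pad_in_box d la : (d <= m)%N -> is_partition d la -> pad la \in box m.
Proof.
move=> dm lad; have ld := size_partition lad; have [_ _ lasum] := lad.
rewrite mem_box size_cat size_nseq subnKC ?eqxx /=; last exact: leq_trans (leqW dm).
by rewrite sumn_cat sumn_nseq mul0n addn0 lasum.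
Qed.

Lemma filter_pad la : 0%N \notin la -> [seq i <- pad la | i != 0%N] = la.
Proof.
move=> la0; rewrite filter_cat filter_nseq cats0; apply/all_filterP/allP => i.
by apply: contraTneq => ->.
Qed.

Lemma sorted_zeros la : sorted geq la ->
  la = [seq i <- la | i != 0%N] ++ nseq (count_mem 0%N la) 0%N.
Proof.
elim: la => // a la IHla; rewrite [sorted _ _]/= path_sortedE; last exact: geq_trans.
move=> /andP[ala las] /=; case: eqP => [a0|_] /=; last by rewrite -IHla.
have la0 : la = nseq (size la) 0%N.
  by apply/all_pred1P/(sub_all _ ala) => i /=; rewrite a0 leqn0.
by rewrite a0 [in RHS]la0 filter_nseq /= count_nseq /= mul1n -la0.
Qed.

Lemma sorted_pad la : sorted geq la -> sorted geq (pad la).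
Proof.
rewrite !(sorted_pairwise geq_trans) pairwise_cat => -> /=.
rewrite -(sorted_pairwise geq_trans); apply/andP; split.
  by apply/allrelP => a b _ /nseqP[->].
by elim: (_ - _)%N => // -[|k].
Qed.

Lemma perm_pad d : (d <= m)%N ->
  perm_eq [seq pad la | la <- fset_set (is_partition d)]
          [seq la <- box m | (sumn la == d) && sorted geq la].
Proof.
move=> dm; have fin := finite_partitions d.
have memP la : la \in fset_set (is_partition d) -> is_partition d la.
  by rewrite in_fset_set// inE.
apply: uniq_perm.
- rewrite map_inj_in_uniq ?fset_uniq// => la la' /memP[_ la0 _] /memP[_ la0' _] E.
  by rewrite -(filter_pad la0) E filter_pad.
- exact: filter_uniq (box_uniq m).
move=> la; rewrite (mem_filter (fun la => (sumn la == d) && sorted geq la)).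
apply/mapP/andP => [[la' /memP lad ->]|[/andP[/eqP lad las] lam]].
  rewrite (pad_in_box dm lad); have [las la0 lasum] := lad.
  by rewrite sumn_cat sumn_nseq mul0n addn0 lasum eqxx sorted_pad.
have laE := sorted_zeros las.
exists [seq i <- la | i != 0%N].
  rewrite in_fset_set// inE; split.
  - by apply: (sorted_filter geq_trans).
  - by rewrite mem_filter.
  - by rewrite -lad [in RHS]laE sumn_cat sumn_nseq mul0n addn0.
move: lam; rewrite mem_box => /andP[/eqP sla _].
rewrite /pad -sla {1}laE; congr (_ ++ nseq _ _).
by rewrite size_filter -(count_predC (pred1 0%N) la) addnK.
Qed.

(** Nothing interlaces with such a la, so extending a sum over partitions to the whole box adds only
    zeros. *)
Lemma schur_of_unsorted (V : choiceType) (R : comNzRingType)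
    (xs : seq (fps V R)) la :
  la \in box m -> ~~ sorted geq la -> schur_of m xs la = 0.
Proof.
move=> lam; case: xs => [|x xs] uns /=.
  case: eqP => // E; move: uns; rewrite E.
  by rewrite (_ : sorted _ _)//; elim: (m) => // -[|k].
rewrite /add_strip big_seq_cond big1// => mu /andP[mum mula]; case/negP: uns.
move: lam mum; rewrite !mem_box => /andP[/eqP sla _] /andP[/eqP smu _].
apply/(sortedP 0%N) => i _.
have [] := interlaceP (etrans smu (esym sla)) mula i.
by move=> h1 h2; exact: leq_trans h1.
Qed.

Lemma sum_schur_of_pad (V : choiceType) (R : comNzRingType)
    (xs ys : seq (fps V R)) d : (d <= m)%N ->
  \sum_(la <- box m | sumn la == d) schur_of m xs la * schur_of m ys la =
  \sum_(la <- fset_set (is_partition d))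
    schur_of m xs (pad la) * schur_of m ys (pad la).
Proof.
move=> dm.
rewrite -(big_map pad xpredT (fun la => schur_of m xs la * schur_of m ys la)).
rewrite (perm_big _ (perm_pad dm)) [RHS]big_filter big_mkcondr.
rewrite [LHS]big_seq_cond [RHS]big_seq_cond; apply: eq_bigr => la /andP[lam _].
by case: ifPn => // las; rewrite schur_of_unsorted// mul0r.
Qed.

End Padding.

Lemma bounded_tableau_pad n N k (T : seq (seq (letter n))) :
  bounded_tableau N (T ++ nseq k [::]) <-> bounded_tableau N T.
Proof.
have E i : nth [::] (T ++ nseq k [::]) i = nth [::] T i.
  by rewrite nth_cat nth_nseq if_same; case: ltnP => // Ti; rewrite nth_default.
by split=> -[srt bnd strict]; split=> [i|i|i j]; move: (srt i) (bnd i);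
  rewrite ?E//; move: (strict i j); rewrite !E.
Qed.

(** * Tableaux of an unpadded shape *)

Section Shapes.
Variables (n m d N : nat) (la : seq nat).
Hypotheses (dm : (d <= m)%N) (lad : is_partition d la).

(** The rows cut off are the empty ones coming from the padding, see [tabs_pad]. *)
Definition shape_tabs : seq (seq (seq (letter n))) :=
  [seq take (size la) T | T <- tabs n m N (pad m la)].

Lemma tabs_pad T : T \in tabs n m N (pad m la) ->
  T = take (size la) T ++ nseq (m.+1 - size la) [::].
Proof.
move=> /(mem_tabs _ _ (pad_in_box dm lad))[Tla _].
have sT : size T = m.+1.
  have := pad_in_box dm lad; rewrite mem_box => /andP[/eqP <- _].
  by rewrite -Tla size_map.
rewrite -{1}(cat_take_drop (size la) T); congr cat.
have : shape (drop (size la) T) = nseq (m.+1 - size la) 0%N.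
  by rewrite /shape map_drop -/(shape T) Tla drop_size_cat.
elim: (drop _ _) (_ - _)%N => [|r U IHU] [|k] //= [/eqP + /IHU ->].
by rewrite size_eq0 => /eqP ->.
Qed.

Lemma mem_shape_tabs T :
  (T \in shape_tabs) <-> shape T = la /\ bounded_tableau N T.
Proof.
have lam := pad_in_box dm lad; split.
  case/mapP => U Ut ->; have UE := tabs_pad Ut.
  have [Ula Ub] := (mem_tabs _ _ lam).1 Ut; split.
    by rewrite /shape map_take -/(shape U) Ula take_size_cat.
  by move: Ub; rewrite {1}UE bounded_tableau_pad.
case=> Tla Tb; have sT : size T = size la by rewrite -Tla size_map.
apply/mapP; exists (T ++ nseq (m.+1 - size la) [::]); last first.
  by rewrite take_size_cat.
apply/(mem_tabs _ _ lam); split; last exact/bounded_tableau_pad.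
by rewrite /shape map_cat map_nseq -/(shape T) Tla.
Qed.

Lemma shape_tabs_uniq : uniq shape_tabs.
Proof.
rewrite map_inj_in_uniq; first exact: tabs_uniq (pad_in_box dm lad).
by move=> T U /tabs_pad TE /tabs_pad UE E; rewrite TE UE E.
Qed.

Lemma sum_shape_tabs (V : choiceType) (R : comNzRingType) (z : letter n -> fps V R) :
  \sum_(T <- shape_tabs) \prod_(a <- flatten T) z a =
  schur_of m [seq \sum_k z (i, k) | i <- rev (iota 0 N)] (pad m la).
Proof.
rewrite -sum_tabs ?(pad_in_box dm lad)// big_map big_seq [RHS]big_seq.
apply: eq_bigr => T /tabs_pad TE; rewrite [in RHS]TE flatten_cat.
rewrite (_ : flatten (nseq _ _) = [::]) ?cats0//.
by elim: (_ - _)%N.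
Qed.

End Shapes.

(** * The Cauchy identity for power series *)

Lemma sum_count_dots n (s : seq (letter n)) :
  (\sum_(k < n) count (fun a : letter n => a.2 == k) s)%N = size s.
Proof.
elim: s => [|a s IHs] /=; first by rewrite big1.
by rewrite big_split /= IHs (bigD1 a.2)//= eqxx big1 ?addn0// => k /negPf;
  rewrite eq_sym => ->.
Qed.

Lemma fps_order_var (V : choiceType) (R : comNzRingType) (M : {mset V}) v :
  fps_order M 1 (fps_var R v).
Proof.
move=> N _; rewrite /fps_var /fps_mono; case: eqP => // ->.
by rewrite enum_msetn.
Qed.

Lemma eqmod_var (V : choiceType) (R : comNzRingType) (M : {mset V}) v :
  v \notin M -> fps_eqmod M (fps_var R v) 0.
Proof.
move=> vM N NM; rewrite /fps_var /fps_mono; case: eqP => // NE.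
by case/negP: vM; apply: (msubset_subset NM); rewrite NE mset11.
Qed.

Lemma eqmod_mulKl (V : choiceType) (R : comNzRingType) (M : {mset V})
    (Q f g : fps V R) :
  Q \is a GRing.unit -> fps_eqmod M (Q * f) (Q * g) -> fps_eqmod M f g.
Proof.
move=> uQ E; rewrite -[f](mulKr uQ) -[g](mulKr uQ).
exact: eqmod_mul.
Qed.

(** * Dotted Schur series modulo a monomial *)

Section Specialisation.
Variables (V : choiceType) (R : comNzRingType) (n m d N : nat) (h : letter n -> V).
Variables (M : {mset V}) (la : seq nat).
Hypotheses (h_inj : injective h) (hM : forall a, h a \in M -> (a.1 < N)%N).
Hypotheses (dm : (d <= m)%N) (lad : is_partition d la).

Let z a := fps_var R (h a).

(** A tableau contributes only if its monomial is M'. Its variables then divide M, so by [hM] its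
    letters are below N and it is in the finite list. *)
Lemma dotted_schurE mu M' : msubset M' M ->
  dotted_schur la mu z M' =
  \sum_(T <- shape_tabs n m N la |
      [ffun k => count (fun a : letter n => a.2 == k) (flatten T)] == mu)
     (\prod_(a <- flatten T) z a) M'.
Proof.
move=> M'M; have [las _ _] := lad.
pose P T := [ffun k => count (fun a : letter n => a.2 == k) (flatten T)] == mu.
rewrite -[RHS]big_filter fsbig_seq; last exact: filter_uniq (shape_tabs_uniq n N dm lad).
rewrite /dotted_schur; apply/esym/fsbig_widen.
  move=> T /=; rewrite (mem_filter P) => /andP[/eqP muT].
  case/(mem_shape_tabs _ dm lad) => Tla Tb.
  have [_ H] := dotted_tableauP N mu T las.
  by case: H => //; split=> // k; rewrite -muT ffunE.
move=> T [Tmu] /= nT; rewrite -(big_map h xpredT (fun v => fps_var R v)) fps_prod_var.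
rewrite /fps_mono; case: eqP => // M'E; case: nT.
have bnd : all (below N) (flatten T).
  apply/allP => a aT; apply/hM/(msubset_subset M'M).
  by rewrite M'E in_mset mset_seqE -has_count has_pred1 map_f.
have [H _] := dotted_tableauP N mu T las.
have [Tla Tb muT] := H (conj Tmu bnd).
rewrite (mem_filter P); apply/andP; split.
  by apply/eqP/ffunP => k; rewrite ffunE muT.
exact/(mem_shape_tabs _ dm lad).
Qed.

(** Each tableau of shape la has exactly one multidegree, with sum d, so summing over [mu] removes
    the condition on the dots. *)
Lemma eqmod_dotted_schur :
  fps_eqmod M (\sum_(mu \in @multidegrees n d) dotted_schur la mu z)
    (schur_of m [seq \sum_k z (i, k) | i <- rev (iota 0 N)] (pad m la)).
Proof.
move=> M' M'M; rewrite -(sum_shape_tabs N dm lad).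
rewrite fsbig_finite; last exact: finite_multidegrees.
rewrite !fps_sumE.
under eq_bigr => mu _ do rewrite dotted_schurE//.
rewrite (exchange_big_dep xpredT)//= big_seq [RHS]big_seq; apply: eq_bigr => T Tt.
set mu := [ffun k => _].
have mud : mu \in fset_set (@multidegrees n d).
  rewrite in_fset_set ?inE; last exact: finite_multidegrees.
  have [Tla _] := (mem_shape_tabs N dm lad T).1 Tt.
  have [_ _ <-] := lad; rewrite /multidegrees /= -Tla -size_flatten -sum_count_dots.
  by apply: eq_bigr => k _; rewrite ffunE.
rewrite (eq_bigl (pred1 mu)); last by move=> mu' /=; rewrite eq_sym.
by rewrite -big_filter filter_pred1_uniq ?fset_uniq// big_seq1.
Qed.

End Specialisation.

Lemma fsbig_distrlr (A : comNzRingType) (I J : choiceType) (P : set I) (Q : set J)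
    (F : I -> A) (G : J -> A) : finite_set P -> finite_set Q ->
  (\sum_(i \in P) F i) * (\sum_(j \in Q) G j) =
  \sum_(i \in P) \sum_(j \in Q) F i * G j.
Proof.
move=> Pfin Qfin; rewrite [in LHS]fsbig_finite// [X in _ * X]fsbig_finite//.
rewrite big_distrlr [RHS]fsbig_finite//; apply: eq_bigr => i _ /=.
by rewrite [RHS]fsbig_finite.
Qed.

Section CauchySeries.
Variables (V : choiceType) (R : comNzRingType) (n : nat).
Variables (hx hy : letter n -> V) (idx : V -> nat).
Hypotheses (hx_inj : injective hx) (hy_inj : injective hy).
Hypotheses (idx_hx : forall a, idx (hx a) = a.1) (idx_hy : forall a, idx (hy a) = a.1).

Local Notation series := (fps V R).
Local Notation xv := (fun a => fps_var R (hx a)).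
Local Notation yv := (fun a => fps_var R (hy a)).

Definition degree_term (d : nat) : series :=
  \sum_(la \in is_partition d)
    \sum_(mu \in @multidegrees n d) \sum_(nu \in @multidegrees n d)
      dotted_schur la mu xv * dotted_schur la nu yv.

Definition xsum (i : nat) : series := \sum_(k < n) fps_var R (hx (i, k)).
Definition ysum (j : nat) : series := \sum_(l < n) fps_var R (hy (j, l)).

(** Modulo such an M, the variables of index at least N vanish and finitely many X_i and Y_j
    remain. *)
Definition bounds (N : nat) (M : {mset V}) : Prop :=
  forall v, v \in M -> (idx v < N)%N.

Lemma exists_bound M : exists N, bounds N M.
Proof.
exists (\max_(v <- finsupp M) idx v).+1 => v vM; rewrite ltnS.
by apply: (@leq_bigmax_seq _ _ _ idx v) => //; rewrite msuppE.
Qed.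

Lemma xsum_order M i : fps_order M 1 (xsum i).
Proof. by apply: fps_order_sum => k _ _; exact: fps_order_var. Qed.

Lemma eqmod_xsum M N i : bounds N M -> (N <= i)%N -> fps_eqmod M (xsum i) 0.
Proof.
move=> NM Ni; apply: eqmod_sum0 => k _ _; apply: eqmod_var; apply/negP => /NM.
by rewrite idx_hx ltnNge Ni.
Qed.

Lemma eqmod_ysum M N j : bounds N M -> (N <= j)%N -> fps_eqmod M (ysum j) 0.
Proof.
move=> NM Nj; apply: eqmod_sum0 => k _ _; apply: eqmod_var; apply/negP => /NM.
by rewrite idx_hy ltnNge Nj.
Qed.

Section Bounded.
Variables (M : {mset V}) (m N : nat).
Hypothesis NM : bounds N M.

Let xs := [seq xsum i | i <- rev (iota 0 N)].
Let ys := [seq ysum j | j <- rev (iota 0 N)].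

Lemma eqmod_degree_term d : (d <= m)%N ->
  fps_eqmod M (degree_term d)
    (\sum_(la <- box m | sumn la == d) schur_of m xs la * schur_of m ys la).
Proof.
move=> dm; rewrite /degree_term fsbig_finite; last exact: finite_partitions.
rewrite sum_schur_of_pad//.
apply: eqmod_sum => la; rewrite in_fset_set; last exact: finite_partitions.
rewrite inE => lad _.
(* The two multidegrees vary independently, so the double sum is a product of two Schur
   functions. *)
rewrite -fsbig_distrlr; [|exact: finite_multidegrees..].
apply: eqmod_mul.
  by apply: eqmod_dotted_schur => // a /NM; rewrite idx_hx.
by apply: eqmod_dotted_schur => // a /NM; rewrite idx_hy.
Qed.

(** The Schur function in the X_i alone provides the order. This makes the sum over degrees
    converge. *)
Lemma degree_term_order d : (d <= m)%N -> fps_order M d (degree_term d).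
Proof.
move=> dm M' M'M M'd; rewrite eqmod_degree_term//.
move: M' M'M M'd; apply: fps_order_sum => la lam /eqP <-.
rewrite -[sumn la]addn0; apply: fps_order_mul => //.
by apply: schur_of_order => // x /mapP[i _ ->]; exact: xsum_order.
Qed.

Lemma eqmod_sum_degree_term :
  fps_eqmod M (\sum_(d < m.+1) degree_term d)
    (\sum_(la <- box m) schur_of m xs la * schur_of m ys la).
Proof.
apply: (@eqmod_trans _ _ _ (\sum_(d < m.+1)
    \sum_(la <- box m | sumn la == d) schur_of m xs la * schur_of m ys la)).
  by apply: eqmod_sum => d _ _; apply: eqmod_degree_term; rewrite -ltnS.
apply: eqmod_eq; rewrite (exchange_big_dep xpredT)//= big_seq [RHS]big_seq.
apply: eq_bigr => la; rewrite mem_box => /andP[_ lale].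
rewrite (big_pred1 (inord (sumn la)))// => d /=.
by rewrite -val_eqE /= inordK// eq_sym.
Qed.

(** Outside the square of indices below N a factor contains a vanishing X_i or Y_j, so it is 1
    modulo M. *)
Lemma eqmod_prod_factors (J : {fset nat * nat}) :
  (forall i j, (i < N)%N -> (j < N)%N -> (i, j) \in J) ->
  fps_eqmod M (\prod_(ij <- J) (1 - xsum ij.1 * ysum ij.2))
              (\prod_(y <- ys) \prod_(x <- xs) (1 - x * y)).
Proof.
move=> HJ; pose small (ij : nat * nat) := (ij.1 < N)%N && (ij.2 < N)%N.
rewrite (bigID small) /= -[X in fps_eqmod _ _ X]mulr1; apply: eqmod_mul; last first.
  apply: eqmod_prod1 => -[i j] _; rewrite negb_and -!leqNgt /= => ij.
  rewrite -[X in fps_eqmod _ _ X]subr0; apply: eqmod_add => //; apply: eqmod_opp.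
  case/orP: ij => [Ni|Nj].
    by rewrite -(mul0r (ysum j)); apply: eqmod_mul => //; exact: eqmod_xsum NM Ni.
  by rewrite -(mulr0 (xsum i)); apply: eqmod_mul => //; exact: eqmod_ysum NM Nj.
apply: eqmod_eq; rewrite -big_filter.
have /(perm_big _) -> : perm_eq [seq ij <- J | small ij]
    [seq (i, j) | i <- rev (iota 0 N), j <- rev (iota 0 N)].
  apply: uniq_perm; first by rewrite filter_uniq// fset_uniq.
    by rewrite allpairs_uniq ?rev_uniq ?iota_uniq// => -[? ?] [? ?] _ _ [-> ->].
  move=> [i j]; rewrite mem_filter; apply/andP/allpairsP.
    move=> [/andP[iN jN] _]; exists (i, j).
    by rewrite !mem_rev !mem_iota !add0n.
  by case=> -[i' j'] /= []; rewrite !mem_rev !mem_iota !add0n /= => iN jN [-> ->];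
    rewrite /small /= iN jN; split=> //; exact: HJ.
rewrite big_allpairs_dep exchange_big big_map; apply: eq_bigr => j _.
by rewrite big_map.
Qed.

End Bounded.

Lemma factor_unit i j : 1 - xsum i * ysum j \is a GRing.unit.
Proof.
apply: fps_unit_subr1.
(* Modulo the empty monomial only the constant coefficient is visible. *)
have H : fps_order mset0 1 (xsum i * ysum j).
  by rewrite mulrC; apply: fps_order_mull; exact: xsum_order.
by apply: H; rewrite ?msubset_refl// size_mset0.
Qed.

(** Multiplying by the product of the factors, which is a unit, reduces this to
    [truncated_cauchy]. *)
Lemma eqmod_prod_inverse M m N (J : {fset nat * nat}) :
  bounds N M -> (size M <= m)%N ->
  (forall i j, (i < N)%N -> (j < N)%N -> (i, j) \in J) ->
  fps_eqmod M (\prod_(ij <- J) (1 - xsum ij.1 * ysum ij.2)^-1)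
              (\sum_(d < m.+1) degree_term d).
Proof.
move=> NM Mm HJ.
pose Q := \prod_(ij <- J) (1 - xsum ij.1 * ysum ij.2).
have uQ : Q \is a GRing.unit by apply: rpred_prod => ij _; exact: factor_unit.
apply: (eqmod_mulKl uQ); rewrite -big_split /=.
rewrite (eq_bigr (fun=> 1)) => [|ij _]; last by rewrite mulrV// factor_unit.
rewrite big1_eq; apply: eqmod_sym.
apply: (eqmod_trans (eqmod_mul (eqmod_prod_factors NM HJ)
                               (eqmod_sum_degree_term m NM))).
by apply: truncated_cauchy => // x /mapP[i _ ->]; exact: xsum_order.
Qed.

Lemma dotted_cauchy : exists P : series,
  fps_has_sum degree_term P /\
  fps_has_prod (fun ij : nat * nat =>
    (1 - \sum_(k < n) \sum_(l < n)
           fps_var R (hx (ij.1, k)) * fps_var R (hy (ij.2, l)))^-1) P.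
Proof.
(* Terms of degree above that of M do not reach the coefficient of M, so the partial sum up to that
   degree already gives its limit. *)
exists (fun M : {mset V} => (\sum_(d < (size M).+1) degree_term d) M); split=> M.
  exists [fset d in iota 0 (size M).+1]%fset => J sJ.
  have [N NM] := exists_bound M.
  rewrite !fps_sumE (bigID (fun d => (d < (size M).+1)%N)) /=.
  rewrite [X in _ + X]big1 ?addr0 => [|d]; last first.
    rewrite -leqNgt => Md.
    by apply: (degree_term_order NM (leqnn d)) => //; exact: msubset_refl.
  rewrite -big_filter -(big_mkord xpredT (fun d => degree_term d M)).
  apply: perm_big; apply: uniq_perm; rewrite ?iota_uniq ?filter_uniq ?fset_uniq//.
  move=> d; rewrite mem_filter mem_index_iota /=.
  have [dM|//] := ltnP d (size M).+1; apply: (fsubsetP sJ).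
  by rewrite in_fset -[is_true _]/(is_true (d \in iota 0 (size M).+1)) mem_iota.
have [N NM] := exists_bound M.
exists [fset ij in [seq (i, j) | i <- iota 0 N, j <- iota 0 N]]%fset => J sJ.
under eq_bigr => ij _ do rewrite -big_distrlr.
apply: (eqmod_prod_inverse NM (leqnn _)) => //; last exact: msubset_refl.
move=> i j iN jN; apply: (fsubsetP sJ); rewrite in_fset /=.
by apply/allpairsP; exists (i, j); rewrite !mem_iota !add0n.
Qed.

End CauchySeries.

Unset Implicit Arguments.

Theorem theorem8p2 (R : comNzRingType) (n : nat) :
  exists P : fps (letter n + letter n)%type R,
    fps_has_sum
      (fun m : nat =>
         \sum_(la \in is_partition m)
           \sum_(mu \in @multidegrees n m) \sum_(nu \in @multidegrees n m)
             dotted_schur la mu (@xvar R n) * dotted_schur la nu (@yvar R n)) P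
    /\ fps_has_prod
      (fun ij : nat * nat =>
         (1 - \sum_(k < n) \sum_(l < n) xvar R (ij.1, k) * yvar R (ij.2, l))^-1)
      P.
Proof.
(* The index of a variable is the number i of its letter, in either alphabet. *)
by apply: (@dotted_cauchy _ R n inl inr
  (fun v => match v with inl a | inr a => a.1 end)) => // a b [].
Qed.
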